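(* Let $H\in\{H_1,H_2\}$. For all integers $k\ge 1$ and $r$ with $0\le r\le k$, \[GR_k((k-r)K_3,rH)=\begin{cases}5^{(k-r)/2}\cdot 17^{r/2}+1, & \text{if } k-r \text{ and } r \text{ are both even},\\ 2\cdot 5^{(k-r-1)/2}\cdot 17^{r/2}+1, & \text{if } k-r \text{ is odd and } r \text{ is even},\\ 8\cdot 5^{(k-r-1)/2}\cdot 17^{(r-1)/2}+1, & \text{if } k-r \text{ and } r \text{ are both odd},\\ 4\cdot 5^{(k-r)/2}\cdot 17^{(r-1)/2}+1, & \text{if } k-r \text{ is even and } r \text{ is odd}.\end{cases}\]
   Context: All graphs are finite, simple and undirected. $K_n$ denotes the complete graph on $n$ vertices. $H_1$ is the 5-vertex graph consisting of $K_4$ together with one additional vertex adjacent to exactly one vertex of the $K_4$; $H_2$ is the 5-vertex graph consisting of $K_4$ together with one additional vertex adjacent to exactly two vertices of the $K_4$. An edge coloring of a complete graph is a Gallai coloring if it contains no rainbow triangle (a triangle whose three edges receive three distinct colors). For graphs $F_1,\dots,F_k$, $GR(F_1,\dots,F_k)$ is the minimum integer $n$ such that every Gallai coloring of $K_n$ with colors $1,\dots,k$ contains, for some $i\in\{1,\dots,k\}$, a monochromatic copy of $F_i$ in color $i$. The notation $GR_k((k-r)K_3,rH)$ means $GR(F_1,\dots,F_k)$ with $F_1=\dots=F_r=H$ and $F_{r+1}=\dots=F_k=K_3$; i.e., the first $r$ colors are assigned to $H$ and the last $k-r$ colors are assigned to $K_3$. *)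

(* Defs.v *)
From HB Require Import structures.
From mathcomp Require Import all_boot.

Set Implicit Arguments.
Unset Strict Implicit.
Unset Printing Implicit Defensive.

Record sgraph := SGraph {
  vertex :> finType;
  adj : rel vertex;
  adj_sym : symmetric adj;
  adj_irr : irreflexive adj
}.

Section CompleteGraph.
Variable n : nat.

Definition complete_adj : rel 'I_n := fun u v => u != v.

Lemma complete_adj_sym : symmetric complete_adj.
Proof. by move=> u v; rewrite /complete_adj eq_sym. Qed.

Lemma complete_adj_irr : irreflexive complete_adj.
Proof. by move=> u; rewrite /complete_adj eqxx. Qed.

Definition complete_graph := SGraph complete_adj_sym complete_adj_irr.
End CompleteGraph.

(* K_4 on the vertices [Some _], together with an additional vertex [None]
   adjacent to exactly the first d vertices of the K_4 (for d <= 4). *)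
Section K4Plus.
Variable d : nat.

Definition K4_plus_adj : rel (option 'I_4) := fun u v =>
  match u, v with
  | Some i, Some j => i != j
  | Some i, None | None, Some i => i < d
  | None, None => false
  end.

Lemma K4_plus_adj_sym : symmetric K4_plus_adj.
Proof. by case=> [i|] [j|] //=; rewrite eq_sym. Qed.

Lemma K4_plus_adj_irr : irreflexive K4_plus_adj.
Proof. by case=> [i|] //=; rewrite eqxx. Qed.

Definition K4_plus := SGraph K4_plus_adj_sym K4_plus_adj_irr.
End K4Plus.

Definition H1 : sgraph := K4_plus 1.
Definition H2 : sgraph := K4_plus 2.

(* The color of the edge xy of K_n (x != y) is c x y; the diagonal values c x x
   carry no meaning and are never used below. *)
Definition edge_coloring (n k : nat) (c : 'I_n -> 'I_n -> 'I_k) : Prop :=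
  forall x y, c x y = c y x.

Definition rainbow_triangle (n k : nat) (c : 'I_n -> 'I_n -> 'I_k)
    (x y z : 'I_n) : bool :=
  uniq [:: x; y; z] && uniq [:: c x y; c y z; c x z].

Definition Gallai_coloring (n k : nat) (c : 'I_n -> 'I_n -> 'I_k) : Prop :=
  edge_coloring c /\ forall x y z, ~~ rainbow_triangle c x y z.

(* Copies are subgraphs, not necessarily induced. *)
Definition mono_copy (n k : nat) (c : 'I_n -> 'I_n -> 'I_k)
    (F : sgraph) (i : 'I_k) : Prop :=
  exists f : F -> 'I_n,
    injective f /\ forall u v : F, adj u v -> c (f u) (f v) = i.

Definition Gallai_arrows (k : nat) (F : 'I_k -> sgraph) (n : nat) : Prop :=
  forall c : 'I_n -> 'I_n -> 'I_k,
    Gallai_coloring c -> exists i : 'I_k, mono_copy c (F i) i.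

(* GR(F_1, ..., F_k) = N, i.e. the minimum exists and equals N. *)
Definition is_GR (k : nat) (F : 'I_k -> sgraph) (N : nat) : Prop :=
  Gallai_arrows F N /\ forall n, Gallai_arrows F n -> N <= n.

(* Colors are numbered from 0: the first r of the k colors are assigned to H
   and the remaining k - r to K_3. *)
Definition targets (k r : nat) (H : sgraph) (i : 'I_k) : sgraph :=
  if i < r then H else complete_graph 3.

(* Main.v *)
(* The four cases are 1 + f(k - r, r) for the product f(s, r) = A(s) B(r) of
   A(s) = 5^(s/2) or 2 5^((s-1)/2) and B(r) = 17^(r/2) or 4 17^((r-1)/2),
   according to parity.

   Upper bound, by induction on the set S of vertices, for H_2, which contains
   H_1.  Gallai's theorem partitions S into parts such that only two colors p
   and q occur between parts, with a single color between any two of them.  If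
   S splits in two halves joined in one color, the clique numbers of the halves
   in that color are constrained and the induction hypothesis, in which the
   color has been removed or assigned to a triangle instead of H, bounds each of
   them.  Otherwise every part X has neighbors in both colors.  If X contains an
   edge (or triangle) of color p or q, then S is the union of X and of its
   p- and q-neighborhoods, and p and q are restricted in these three
   sets.  If a K_4 of color q meets several parts, every vertex outside sends it
   at least three edges of color p, so that p is restricted outside.  In the
   remaining case the parts contain neither p nor q, and their number is at most
   R(3,3) - 1 = 5, R(3,4) - 1 = 8 or R(4,4) - 1 = 17.

   Lower bound: blow-ups of the pentagon coloring of K_5 (two triangle colors),
   of the Paley coloring of K_17 (two colors for H), of K_2 (a single triangle
   color) and, innermost, of a monochromatic K_4 (a single color for H); the
   latter has too few vertices to contain H_1, which is connected. *)
Require Import Defs.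
From mathcomp Require Import all_boot.
From mathcomp Require Import zify.
From Stdlib Require Import Classical.

Set Implicit Arguments.
Unset Strict Implicit.
Unset Printing Implicit Defensive.

(** * The extremal function and its growth *)

Definition triangle_factor a := (if odd a then 2 else 1) * 5 ^ a./2.
Definition H_factor b := (if odd b then 4 else 1) * 17 ^ b./2.
Definition gr_bound a b := triangle_factor a * H_factor b.

Lemma gr_bound_gt0 a b : 0 < gr_bound a b.
Proof. by rewrite !muln_gt0 !expn_gt0; do 2!case: ifP. Qed.

Lemma gr_bound_SS a b : gr_bound a.+2 b = 5 * gr_bound a b.
Proof. by rewrite /gr_bound /triangle_factor /= negbK expnS mulnCA !mulnA. Qed.

Lemma gr_bound_rSS a b : gr_bound a b.+2 = 17 * gr_bound a b.
Proof.
rewrite /gr_bound /H_factor /= negbK expnS; lia.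
Qed.

(** Each new triangle color multiplies the value by 2 or 5/2, alternately. *)
Lemma gr_bound_S a b :
  2 * gr_bound a b <= gr_bound a.+1 b /\ 2 * gr_bound a.+1 b <= 5 * gr_bound a b.
Proof.
rewrite /gr_bound /triangle_factor /= uphalf_half; case: (odd a) => /=.
  by rewrite expnS; split; nia.
by rewrite add0n; split; nia.
Qed.

(** Each new color for H multiplies the value by 4 or 17/4, alternately. *)
Lemma gr_bound_rS a b :
  4 * gr_bound a b <= gr_bound a b.+1 /\ 4 * gr_bound a b.+1 <= 17 * gr_bound a b.
Proof.
rewrite /gr_bound /H_factor /= uphalf_half; case: (odd b) => /=.
  by rewrite expnS; split; nia.
by rewrite add0n; split; nia.
Qed.

(** With g = [gr_bound a b], the hypothesis gives m <= 3/2 * 5/2 * g = 15/4 * g < 4 * g. The strict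
    inequality leaves room for one more vertex. *)
Lemma gr_bound_isolated_triangles m a b :
  2 * m <= 3 * gr_bound a.+1 b -> m < gr_bound a b.+1.
Proof.
have := gr_bound_gt0 a b; have [+ _] := gr_bound_rS a b.
rewrite /gr_bound /triangle_factor /= uphalf_half; case: (odd a) => /=.
  by rewrite expnS; nia.
by rewrite add0n; nia.
Qed.

(** * Gallai partitions *)

Section GallaiColoring.
Variables (T C : finType) (c : T -> T -> C).
Hypothesis csym : forall x y, c x y = c y x.
Hypothesis cgal : forall x y z, x != y -> y != z -> x != z ->
  [|| c x y == c y z, c y z == c x z | c x y == c x z].

(** The diagonal of [c] carries no meaning, hence the condition [x != y]. *)
Definition cedge i x y := (x != y) && (c x y == i).

Lemma cedgeC i x y : cedge i x y = cedge i y x.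
Proof. by rewrite /cedge eq_sym csym. Qed.

Lemma cedge_neq i x y : cedge i x y -> x != y.
Proof. by case/andP. Qed.

Lemma cedge_eq i x y : cedge i x y -> c x y = i.
Proof. by case/andP=> _ /eqP. Qed.

Lemma cedgeI x y : x != y -> cedge (c x y) x y.
Proof. by rewrite /cedge eqxx andbT. Qed.

Lemma gallai_third i x y z : y != z -> cedge i x z ->
  ~~ cedge i x y -> ~~ cedge i z y -> x != y -> c x y = c z y.
Proof.
move=> yz /andP[xz /eqP xzi] nxy nzy xy.
move: nxy nzy (cgal xz (y := z) (z := y)).
rewrite /cedge xy (eq_sym z) yz /= => h1 h2 /(_ isT isT).
rewrite xzi (eq_sym i) (negbTE h2) (eq_sym i) (negbTE h1) orbF /=.
by move/eqP.
Qed.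

Definition inner i (S : {set T}) : rel T :=
  fun x y => [&& x \in S, y \in S & cedge i x y].

Lemma inner_connect_sym i S : connect_sym (inner i S).
Proof.
by apply: sym_connect_sym => x y; rewrite /inner cedgeC andbCA.
Qed.

Lemma inner_connect_in i (S : {set T}) x y :
  x \in S -> connect (inner i S) x y -> y \in S.
Proof.
move=> xS /connectP[p pP ->] {y}.
elim: p x xS pP => //= z p IH x xS /andP[/and3P[_ zS _]]; exact: IH.
Qed.

(* A component of one color is a module: an outside vertex sees it in a
   single color, as otherwise it would form a rainbow triangle with some edge
   of the component. *)
Lemma component_module i (S : {set T}) x x' y :
  x \in S -> y \in S -> ~~ connect (inner i S) x y ->
  connect (inner i S) x x' -> c x y = c x' y.
Proof.
move=> xS yS nxy /connectP[p pP ->] {x'}.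
elim: p x xS nxy pP => //= z p IH x xS nxy /andP[xz pP].
have /and3P[_ zS exz] := xz.
have nzy : ~~ connect (inner i S) z y.
  by apply: contra nxy; apply: connect_trans; apply: connect1.
rewrite -(IH z) //; apply: (gallai_third _ exz).
- by apply: contraNneq nzy => ->.
- by apply: contra nxy => e; apply: connect1; rewrite /inner xS yS.
- by apply: contra nzy => e; apply: connect1; rewrite /inner zS yS.
- by apply: contraNneq nxy => ->.
Qed.

Definition two_colored p q (S : {set T}) :=
  forall x y, x \in S -> y \in S -> x != y -> c x y = p \/ c x y = q.

(** By the first clause, contracting the components of color [i] shrinks [S]; by the second, at
    least two components remain. *)
Definition disconnected i (S : {set T}) :=
  (exists x y, [/\ x \in S, y \in S & cedge i x y]) /\
  exists x y, [/\ x \in S, y \in S & ~~ connect (inner i S) x y].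

Lemma disconnected_closed i (S A : {set T}) u v x y :
  u \in S -> v \in S -> cedge i u v ->
  x \in S -> y \in S -> x \in A -> y \notin A ->
  (forall a b, a \in A -> b \in S -> b \notin A -> ~~ cedge i a b) ->
  disconnected i S.
Proof.
move=> uS vS uv xS yS xA yA cA; split; first by exists u, v.
exists x, y; split=> //; apply: contra yA => /connectP[p pP ->] {y yS}.
elim: p x xS xA pP => //= z p IH x xS xA /andP[/and3P[_ zS xz]].
apply: IH => //; apply: contraLR xz => zA; exact: cA.
Qed.

(** Induction by removal of a vertex [v]. A color that disconnects the rest still disconnects [S]
    unless [v] has a neighbor of that color in each component; then the component of a vertex that
    [v] sees in another color is joined to the other components in a single color. *)
Lemma two_colored_or_disconnected n (S : {set T}) : #|S| = n.+1 ->
  (exists p q, two_colored p q S) \/ exists i, disconnected i S.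
Proof.
elim: n S => [|n IH] S cS.
  have /cards1P[x ->] : #|S| == 1 by rewrite cS.
  left; exists (c x x), (c x x) => y z; rewrite !inE => /eqP-> /eqP->.
  by rewrite eqxx.
have [v vS] : exists v, v \in S by apply/card_gt0P; rewrite cS.
pose S' := S :\ v.
have cS' : #|S'| = n.+1 by move: (cardsD1 v S); rewrite vS cS => -[].
have S'S x : x \in S' -> x \in S by case/setD1P.
have S'v x : x \in S' -> x != v by case/setD1P.
have inS x : x \in S -> x = v \/ x \in S'.
  by move=> xS; case: (eqVneq x v) => [|n0]; [left|right; rewrite !inE n0].
have vnS' : v \notin S' by rewrite !inE eqxx.
clearbody S'.
(* If v sees all other vertices in one color, it is isolated in every other
   color used. *)
have allv i x y : (forall z, z \in S' -> c v z = i) -> x \in S' -> y \in S' ->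
    x != y -> c x y != i -> exists j, disconnected j S.
  move=> vi xS yS xy nxy; exists (c x y).
  apply: (@disconnected_closed _ _ [set v] x y v x) => //; rewrite ?S'S ?inE //.
  - exact: cedgeI.
  - exact: S'v.
  move=> a b; rewrite !inE => /eqP-> bS bv; rewrite /cedge negb_and.
  case: (inS b bS) bv => [->|bS'] bv; first by rewrite eqxx in bv.
  by rewrite vi // (eq_sym i) nxy orbT.
case: (IH S' cS') => [[p [q pq]]|[r [[x0 [y0 [x0S y0S xy0]]] [x1 [y1 [x1S y1S nxy]]]]]].
  case: (classic (forall x, x \in S' -> c v x = p \/ c v x = q)) => [vpq|].
    left; exists p, q => x y /inS[->|xS] /inS[->|yS] xy; rewrite ?eqxx // in xy *.
    - exact: vpq.
    - rewrite csym; exact: vpq.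
    - exact: pq.
  move=> /not_all_ex_not[x /(imply_to_and (x \in S'))[xS /not_or_and[vxp vxq]]].
  case: (classic (forall z, z \in S' -> c v z = c v x)) => [vx|].
    case: (classic (exists2 y, y \in S' & y != x)) => [[y yS yx]|ny].
      right; apply: (allv _ y x vx) => //.
      by case: (pq y x yS xS yx) => ->; apply/eqP => e; [apply: vxp|apply: vxq].
    have S2 y : y \in S -> y = v \/ y = x.
      case/inS => [|yS]; [by left|right].
      by apply/eqP; apply: contra_notT ny => ?; exists y.
    left; exists (c v x), (c v x) => y z /S2[]-> /S2[]->; rewrite ?eqxx //.
    - by left.
    - by left; rewrite csym.
  move=> /not_all_ex_not[y /(imply_to_and (y \in S'))[yS /eqP vy]].
  (* The color of [vx] is neither [p] nor [q], and [y] does not see [v] in it, so [y] is isolated in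
     this color. *)
  right; exists (c v x).
  apply: (@disconnected_closed _ _ [set y] v x y v) => //; rewrite ?inE ?eqxx ?S'S //.
  - by apply: cedgeI; rewrite eq_sym S'v.
  - by rewrite eq_sym S'v.
  move=> a b; rewrite !inE => /eqP-> bS ab; rewrite /cedge eq_sym ab /=.
  case: (inS b bS) => [->|bS']; first by rewrite csym.
  case: (pq y b yS bS'); first (by rewrite eq_sym); move=> ->.
    by apply/eqP => e; apply: vxp.
  by apply/eqP => e; apply: vxq.
pose e := inner r S'.
(* A component of color [r] in which [v] has no neighbor of color [r] is still closed in [S].
   Otherwise [v] has such a neighbor in every component. *)
case: (classic (forall x, x \in S' -> exists2 z, connect e x z & z \in S' /\ c v z = r)); last first.
  move=> /not_all_ex_not[x /(imply_to_and (x \in S'))[xS nx]]; right; exists r.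
  have nv z : connect e x z -> z \in S' -> c v z != r.
    by move=> xz zS; apply/eqP => vz; apply: nx; exists z.
  apply: (@disconnected_closed _ _ [set z | connect e x z & z \in S'] x0 y0 x v) => //;
    rewrite ?inE ?eqxx ?S'S ?connect0 ?(negbTE vnS') ?andbF //.
  move=> a b; rewrite inE => /andP[xa aS] bS nb; apply/negP => ab.
  case: (inS b bS) => [bv|bS'].
    by move: (nv a xa aS); rewrite csym -bv (cedge_eq ab) eqxx.
  case/negP: nb; rewrite inE bS' andbT; apply: connect_trans xa (connect1 _).
  by rewrite /e /inner aS bS'.
move=> redv; case: (classic (forall x, x \in S' -> c v x = r)) => [vr|].
  have xy1 : x1 != y1 by apply: contraNneq nxy => ->.
  right; apply: (allv r x1 y1) => //.
  apply: contra nxy => e1; apply: connect1; by rewrite /inner x1S y1S /cedge e1 andbT.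
move=> /not_all_ex_not[x /(imply_to_and (x \in S'))[xS /eqP vxr]].
(* The component of [y] contains [z] with [vz] of color [r]. Being a module, it gives [x'y] and
   [x'z] the same color, and the triangle [v], [z], [x'] gives [x'z] the color of [vx']. *)
have out x' y : connect e x x' -> c v x' != r -> y \in S' -> ~~ connect e x y ->
    c x' y = c v x'.
  move=> xx' vx' yS nxy'.
  have x'S := inner_connect_in xS xx'.
  have nx'y : ~~ connect e x' y by apply: contra nxy'; apply: connect_trans.
  case: (redv y yS) => z yz [zS vz].
  have nx'z : ~~ connect e x' z.
    by apply: contra nx'y => h; apply: connect_trans h _; rewrite inner_connect_sym.
  have x'z : x' != z by apply: contraNneq nx'z => ->.
  rewrite csym (component_module yS x'S _ yz); last by rewrite inner_connect_sym.
  apply: (@gallai_third r) => //; first exact: S'v.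
  - by rewrite /cedge S'v //= csym vz.
  - apply: contra nx'z => h; apply: connect1.
    by rewrite /e /inner x'S zS cedgeC.
  - by rewrite /cedge negb_and vx' orbT.
  - by rewrite eq_sym.
have [y yS nxy'] : exists2 y, y \in S' & ~~ connect e x y.
  case: (boolP (connect e x x1)) => [xx1|]; last by exists x1.
  exists y1 => //; apply: contra nxy => xy1.
  by apply: connect_trans xy1; rewrite inner_connect_sym.
have outc x' z : connect e x x' -> z \in S' -> ~~ connect e x z -> c x' z = c v x.
  by move=> xx' zS nz; rewrite -(component_module xS zS nz xx') out.
have vc x' : connect e x x' -> c v x' = r \/ c v x' = c v x.
  move=> xx'; case: (eqVneq (c v x') r) => [->|n']; [by left|right].
  by rewrite -(out x' y) // outc.
case: (classic (two_colored r (c v x) S)) => [tc|]; first by left; exists r, (c v x).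
move=> /not_all_ex_not[g /not_all_ex_not[h /(imply_to_and (g \in S))[gS]]].
move=> /(imply_to_and (h \in S))[hS /(imply_to_and (is_true (g != h)))[gh /not_or_and[/eqP ghr /eqP ghb]]].
(* Only [r] and the color of [vx] leave the component of [x], so a third color is confined. *)
right; exists (c g h).
apply: (@disconnected_closed _ _ [set z | connect e x z] g h x v) => //;
  rewrite ?inE ?connect0 ?S'S //; first exact: cedgeI.
  by apply/negP => /(inner_connect_in xS); rewrite (negbTE vnS').
move=> a b; rewrite !inE => xa bS xb; apply/negP => /cedge_eq ab.
case: (inS b bS) => [bv|bS'].
  move: ab; rewrite bv csym; case: (vc a xa) => -> ab.
    by rewrite ab eqxx in ghr.
  by rewrite ab eqxx in ghb.
by move: ab; rewrite outc // => ab; rewrite ab eqxx in ghb.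
Qed.

(* [f x] is a representative of the part of [x]. *)
Definition gallai_partition (S : {set T}) (f : T -> T) p q :=
  [/\ forall x, x \in S -> f x \in S, forall x, x \in S -> f (f x) = f x,
      exists x y, [/\ x \in S, y \in S & f x != f y] &
      forall x y, x \in S -> y \in S -> f x != f y ->
        c x y = c (f x) (f y) /\ (c x y = p \/ c x y = q)].

(** In the two-colored case all parts are singletons. Otherwise the components of a disconnecting
    color are contracted to their roots; as they are modules, a partition of the roots pulls back to
    [S]. *)
Theorem gallai_partition_exists n (S : {set T}) : #|S| <= n -> 1 < #|S| ->
  exists f p q, gallai_partition S f p q.
Proof.
elim: n S => [|n IH] S Sn S1; first by lia.
have cS : #|S| = #|S|.-1.+1 by lia.
case: (two_colored_or_disconnected cS) => [[p [q pq]]|[i [[x0 [y0 [x0S y0S xy0]]] [x1 [y1 [x1S y1S nxy]]]]]].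
  exists id, p, q; split=> //; last by move=> x y xS yS xy; split=> //; apply: pq.
  by case/card_gt1P: S1 => x [y [xS yS xy]]; exists x, y.
pose e := inner i S; have esym : connect_sym e := @inner_connect_sym i S.
pose P := [set root e x | x in S].
have rS x : x \in S -> root e x \in S.
  by move=> xS; apply: inner_connect_in xS (connect_root _ _).
have PS x : x \in P -> x \in S by case/imsetP => y yS ->; exact: rS.
have rP x : x \in P -> root e x = x by case/imsetP => y yS ->; rewrite root_root.
have rr x : x \in S -> root e x \in P by move=> xS; apply: imset_f.
have ltP : #|P| < #|S|.
  rewrite ltn_neqAle leq_imset_card andbT; apply/negP => /imset_injP inj.
  move: (cedge_neq xy0); rewrite (inj x0 y0) ?eqxx //; apply/(rootP esym)/connect1.
  by rewrite /e /inner x0S y0S.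
have gtP : 1 < #|P|.
  apply/card_gt1P; exists (root e x1), (root e y1); split; rewrite ?rr //.
  by rewrite (root_connect esym).
case: (IH P) => [||f [p [q [fP ff [x [y [xP yP fxy]]] fc]]]] //; first by lia.
exists (f \o root e), p, q; split=> [x' xS|x' xS||x' y' xS yS fne] /=.
- by rewrite PS ?fP ?rr.
- by rewrite rP ?ff ?fP ?rr.
- by exists x, y; rewrite !PS //= !rP.
have mod : c x' y' = c (root e x') (root e y').
  have nxy' : ~~ connect e x' y'.
    by apply: contraNN fne => /(rootP esym) /= ->.
  rewrite (component_module xS yS nxy' (connect_root e x')) csym.
  rewrite (component_module yS (rS _ xS) _ (connect_root e y')) 1?csym //.
  by rewrite -(root_connect esym) root_root // eq_sym (root_connect esym).
rewrite mod; exact: fc (rr _ xS) (rr _ yS) fne.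
Qed.

(** * Small Ramsey numbers *)

Definition has_edge i (S : {set T}) :=
  exists x y, [/\ x \in S, y \in S & cedge i x y].

Definition has_triangle i (S : {set T}) :=
  exists x y z, [/\ x \in S, y \in S & z \in S] /\
    [/\ cedge i x y, cedge i x z & cedge i y z].

Definition has_K4 i (S : {set T}) :=
  exists x y z w, [/\ x \in S, y \in S, z \in S & w \in S] /\
    [/\ cedge i x y, cedge i x z, cedge i x w, cedge i y z &
     cedge i y w /\ cedge i z w].

Lemma has_edgeS i (A B : {set T}) : A \subset B -> has_edge i A -> has_edge i B.
Proof.
by move=> /subsetP AB [x [y [xA yA xy]]]; exists x, y; split=> //; exact: AB.
Qed.

Lemma has_triangleS i (A B : {set T}) :
  A \subset B -> has_triangle i A -> has_triangle i B.
Proof.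
move=> /subsetP AB [x [y [z [[xA yA zA] e]]]].
by exists x, y, z; split=> //; split; exact: AB.
Qed.

Lemma has_K4S i (A B : {set T}) : A \subset B -> has_K4 i A -> has_K4 i B.
Proof.
move=> /subsetP AB [x [y [z [w [[xA yA zA wA] e]]]]].
by exists x, y, z, w; split=> //; split; exact: AB.
Qed.

Definition neighbors i (S : {set T}) x := [set y in S | cedge i x y].

Lemma neighbors_sub i (S : {set T}) x : neighbors i S x \subset S.
Proof. by apply/subsetP => y; rewrite inE => /andP[]. Qed.

Lemma neighbors_edge i (S : {set T}) x :
  x \in S -> has_edge i (neighbors i S x) -> has_triangle i S.
Proof.
move=> xS [y [z []]]; rewrite !inE => /andP[yS xy] /andP[zS xz] yz.
by exists x, y, z.
Qed.

Lemma neighbors_triangle i (S : {set T}) x :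
  x \in S -> has_triangle i (neighbors i S x) -> has_K4 i S.
Proof.
move=> xS [y [z [w []]]]; rewrite !inE.
move=> [/andP[yS xy] /andP[zS xz] /andP[wS xw]] [yz yw zw].
by exists x, y, z, w.
Qed.

Lemma two_coloredS p q (A B : {set T}) :
  A \subset B -> two_colored p q B -> two_colored p q A.
Proof. by move=> /subsetP AB pq x y /AB xB /AB; apply: pq. Qed.

Lemma two_coloredC p q (A : {set T}) : two_colored p q A -> two_colored q p A.
Proof.
by move=> pq x y xA yA xy; case: (pq x y xA yA xy); [right|left].
Qed.

Lemma two_colored_edge p q (S : {set T}) x y : two_colored p q S ->
  x \in S -> y \in S -> x != y -> cedge p x y \/ cedge q x y.
Proof.
by move=> pq xS yS xy; case: (pq x y xS yS xy) => <-; [left|right]; apply: cedgeI.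
Qed.

Lemma two_colored_degree p q (S : {set T}) x : two_colored p q S -> x \in S ->
  #|S| <= (#|neighbors p S x| + #|neighbors q S x|).+1.
Proof.
move=> pq xS; rewrite (cardsD1 x S) xS add1n ltnS.
apply: leq_trans (_ : #|neighbors p S x :|: neighbors q S x| <= _).
  apply: subset_leq_card; apply/subsetP => y; rewrite !inE => /andP[yx yS].
  by rewrite yS /=; apply/orP; apply: two_colored_edge pq xS yS _; rewrite eq_sym.
by rewrite cardsU leq_subr.
Qed.

(** Handshake argument: with vertices ordered by [enum_rank], each edge is counted once at its
    smaller and once at its larger end. *)
Lemma odd_degree_sum i (S : {set T}) : ~~ odd (\sum_(x in S) #|neighbors i S x|).
Proof.
pose r := @enum_rank T.
pose D := \sum_(x in S) \sum_(y in S) (cedge i x y && (r x < r y)).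
suff -> : \sum_(x in S) #|neighbors i S x| = D + D by rewrite oddD addbb.
rewrite {2}/D exchange_big -big_split; apply: eq_bigr => x _.
rewrite -big_split -sum1dep_card big_mkcondr; apply: eq_bigr => y _ /=.
rewrite (cedgeC i y x); case: ifP => [/cedge_neq xy|_] //.
by case: ltngtP => // /ord_inj/enum_rank_inj e; rewrite e eqxx in xy.
Qed.

(** In the names [ramsey_a_b], color [p] has no K_a and color [q] no K_b. The later bounds follow
    from the earlier ones in the two neighborhoods of a vertex. *)
Lemma ramsey_2_3 p q (S : {set T}) : two_colored p q S ->
  ~ has_edge p S -> ~ has_triangle q S -> #|S| <= 2.
Proof.
move=> pq np nq; rewrite leqNgt; apply/negP.
case/card_gt2P => x [y [z [[xS yS zS] [xy yz zx]]]]; apply: nq.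
have E u v : u \in S -> v \in S -> u != v -> cedge q u v.
  by move=> uS vS uv; case: (two_colored_edge pq uS vS uv) => // e; case: np; exists u, v.
by exists x, y, z; split=> //; split; apply: E; rewrite // eq_sym.
Qed.

Lemma ramsey_2_4 p q (S : {set T}) : two_colored p q S ->
  ~ has_edge p S -> ~ has_K4 q S -> #|S| <= 3.
Proof.
move=> pq np nq; case: (set_0Vmem S) => [->|[x xS]]; first by rewrite cards0.
apply: leq_trans (two_colored_degree pq xS) _.
have -> : #|neighbors p S x| = 0.
  apply: eq_card0 => y; rewrite inE; apply/negP => /andP[yS xy].
  by apply: np; exists x, y.
rewrite add0n ltnS; have NS := neighbors_sub q S x.
apply: ramsey_2_3 (two_coloredS NS pq) _ _.
  by move=> h; apply: np; apply: has_edgeS h.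
by move=> h; apply: nq; apply: neighbors_triangle h.
Qed.

Lemma ramsey_3_3 p q (S : {set T}) : two_colored p q S ->
  ~ has_triangle p S -> ~ has_triangle q S -> #|S| <= 5.
Proof.
move=> pq np nq; case: (set_0Vmem S) => [->|[x xS]]; first by rewrite cards0.
apply: leq_trans (two_colored_degree pq xS) _.
have h i j : two_colored i j S -> ~ has_triangle i S -> ~ has_triangle j S ->
    #|neighbors i S x| <= 2.
  move=> ij ni nj; have NS := neighbors_sub i S x.
  apply: (ramsey_2_3 (two_coloredS NS ij)) => h.
    by apply: ni; apply: neighbors_edge h.
  by apply: nj; apply: has_triangleS h.
by have := h _ _ pq np nq; have := h _ _ (two_coloredC pq) nq np; lia.
Qed.

(* The recursive bound is 9, and attaining it would require a graph with nine
   vertices of odd degree 3. *)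
Lemma ramsey_3_4 p q (S : {set T}) : two_colored p q S ->
  ~ has_triangle p S -> ~ has_K4 q S -> #|S| <= 8.
Proof.
move=> pq np nq.
have hp x : x \in S -> #|neighbors p S x| <= 3.
  move=> xS; have NS := neighbors_sub p S x.
  apply: (ramsey_2_4 (two_coloredS NS pq)) => h.
    by apply: np; apply: neighbors_edge h.
  by apply: nq; apply: has_K4S h.
have hq x : x \in S -> #|neighbors q S x| <= 5.
  move=> xS; have NS := neighbors_sub q S x.
  apply: (ramsey_3_3 (two_coloredS NS pq)) => h.
    by apply: np; apply: has_triangleS h.
  by apply: nq; apply: neighbors_triangle h.
rewrite leqNgt; apply/negP => S9.
have deg x : x \in S -> #|neighbors p S x| = 3 /\ #|S| = 9.
  by move=> xS; have := two_colored_degree pq xS; have := hp x xS; have := hq x xS; lia.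
have [x xS] : exists x, x \in S by apply/card_gt0P; lia.
have := odd_degree_sum p S.
rewrite (eq_bigr (fun=> 3)) => [|y /deg[]//].
by rewrite sum_nat_const (proj2 (deg x xS)).
Qed.

Lemma ramsey_4_4 p q (S : {set T}) : two_colored p q S ->
  ~ has_K4 p S -> ~ has_K4 q S -> #|S| <= 17.
Proof.
move=> pq np nq; case: (set_0Vmem S) => [->|[x xS]]; first by rewrite cards0.
apply: leq_trans (two_colored_degree pq xS) _.
have h i j : two_colored i j S -> ~ has_K4 i S -> ~ has_K4 j S ->
    #|neighbors i S x| <= 8.
  move=> ij ni nj; have NS := neighbors_sub i S x.
  apply: (ramsey_3_4 (two_coloredS NS ij)) => h.
    by apply: ni; apply: neighbors_triangle h.
  by apply: nj; apply: has_K4S h.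
by have := h _ _ pq np nq; have := h _ _ (two_coloredC pq) nq np; lia.
Qed.

(** * Upper bound *)

(** [x], [y], [z], [w] form the K_4. Further edges at [v] are allowed, as copies need not be
    induced; [v != x] and [v != y] are contained in [cedge]. *)
Definition H2_free i (S : {set T}) := forall x y z w v,
  [/\ x \in S, y \in S, z \in S & w \in S] -> v \in S ->
  [/\ cedge i x y, cedge i x z & cedge i x w] ->
  [/\ cedge i y z, cedge i y w & cedge i z w] ->
  v != z -> v != w -> cedge i v x -> cedge i v y -> False.

Lemma H2_freeS i (A B : {set T}) : A \subset B -> H2_free i B -> H2_free i A.
Proof.
move=> /subsetP AB hB x y z w v [? ? ? ?] ? e1 e2.
by apply: hB e1 e2; [split|]; apply: AB.
Qed.

(* The colors in [K] are those assigned to a triangle, those in [L] the colors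
   assigned to H_1 or H_2. *)
Definition admissible (K L : {set C}) (S : {set T}) :=
  [/\ [disjoint K & L],
      forall x y, x \in S -> y \in S -> x != y -> c x y \in K :|: L,
      forall i, i \in K -> ~ has_triangle i S &
      forall i, i \in L -> H2_free i S].

Lemma admissibleS (K L : {set C}) (A B : {set T}) :
  A \subset B -> admissible K L B -> admissible K L A.
Proof.
move=> AB [dKL cB tB hB]; split=> //.
- by move=> x y xA yA; apply: cB; apply: (subsetP AB).
- by move=> i iK tA; apply: (tB i iK); apply: has_triangleS tA.
- by move=> i iL; apply: H2_freeS AB (hB i iL).
Qed.

(** The induction hypothesis improves in two ways: an absent color is removed (here), and a color
    without triangles is moved to [K] (next lemma). *)
Lemma admissible_drop (K L : {set C}) (S : {set T}) i :
  admissible K L S -> ~ has_edge i S -> admissible (K :\ i) (L :\ i) S.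
Proof.
move=> [dKL cS tS hS] ni; split.
- by apply: disjointWl (subD1set K i) _; apply: disjointWr (subD1set L i) _.
- move=> x y xS yS xy; move: (cS x y xS yS xy); rewrite !inE.
  suff -> : c x y != i by [].
  by apply/eqP => e; apply: ni; exists x, y; rewrite /cedge xy e eqxx.
- by move=> j /setD1P[_]; apply: tS.
- by move=> j /setD1P[_]; apply: hS.
Qed.

Lemma admissible_demote (K L : {set C}) (S : {set T}) i :
  admissible K L S -> ~ has_triangle i S -> admissible (i |: K) (L :\ i) S.
Proof.
move=> [dKL cS tS hS] ni; split.
- apply/pred0P => j /=; rewrite !inE; case: eqVneq => //= _.
  by apply/negP => /andP[jK jL]; rewrite (disjointFr dKL jK) in jL.
- move=> x y xS yS xy; move: (cS x y xS yS xy); rewrite !inE.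
  by case: eqVneq => //= _ ->.
- by move=> j /setU1P[->|] //; apply: tS.
- by move=> j /setD1P[_]; apply: hS.
Qed.

(* Two vertices of each triangle are kept. *)
Lemma isolated_triangles_trim n i (S : {set T}) : #|S| <= n ->
  (forall x y z v, [/\ x \in S, y \in S & z \in S] -> v \in S ->
     [/\ cedge i x y, cedge i x z & cedge i y z] ->
     v != y -> v != z -> ~ cedge i v x) ->
  exists A : {set T}, [/\ A \subset S, ~ has_triangle i A & 2 * #|S| <= 3 * #|A|].
Proof.
elim: n S => [|n IH] S Sn iso.
  by exists S; split=> //; [case=> x [y [z [[xS _ _] _]]]; move: Sn;
     rewrite (cardsD1 x) xS | rewrite leq_mul2r orbT].
case: (classic (has_triangle i S)) => [[x [y [z [[xS yS zS] [xy xz yz]]]]]|nt]; last first.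
  by exists S; split=> //; rewrite leq_mul2r orbT.
pose R := S :\ x :\ y :\ z.
have cR : #|S| = #|R|.+3.
  rewrite (cardsD1 x S) xS (cardsD1 y) (cardsD1 z (S :\ x :\ y)) !inE yS zS.
  by rewrite !(eq_sym _ x) !(eq_sym z) (cedge_neq xy) (cedge_neq xz) (cedge_neq yz).
have RS : R \subset S by rewrite /R !subDset !subsetU ?subxx ?orbT.
have [|x' y' z' v' [? ? ?] ?|A [AR tA cA]] := IH R; first by lia.
  by apply: iso => //; [split|]; apply: (subsetP RS).
have nA u : u \in A -> [/\ u != x, u != y & u != z].
  by move=> /(subsetP AR); rewrite !inE => /and4P[-> -> ->].
exists (x |: (y |: A)); split.
- by rewrite !subUset !sub1set xS yS (subset_trans AR RS).
(* By isolation, [x] and [y] have no neighbor of color [i] in the kept set except each other. *)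
- have only u v : u \in [set x; y] -> v \in x |: (y |: A) -> cedge i u v ->
      v \in [set x; y] /\ v != u.
    move=> u2; rewrite !inE orbA => /orP[v2 e|vA e].
      by split=> //; rewrite eq_sym (cedge_neq e).
    have [vx vy vz] := nA v vA; have vS := subsetP RS _ (subsetP AR _ vA).
    rewrite cedgeC in e; case/set2P: u2 e => -> e.
      by case: (iso x y z v).
    by case: (iso y x z v) => //; split=> //; rewrite cedgeC.
  have two u v w : u \in [set x; y] -> v \in x |: (y |: A) ->
      w \in x |: (y |: A) -> cedge i u v -> cedge i u w -> ~ cedge i v w.
    move=> u2 vA wA uv uw /cedge_neq vw.
    have [v2 vu] := only u v u2 vA uv; have [w2 wu] := only u w u2 wA uw.
    move: u2 v2 w2 vu wu vw; do 3!(case/set2P => ->); rewrite ?eqxx //.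
  case=> u [v [w [[uA vA wA] [uv uw vw]]]].
  case: (boolP (u \in [set x; y])) => [u2|u2]; first exact: (two u v w).
  case: (boolP (v \in [set x; y])) => [v2|v2].
    by apply: (two v u w) => //; rewrite cedgeC.
  case: (boolP (w \in [set x; y])) => [w2|w2].
    by apply: (two w u v) => //; rewrite cedgeC.
  have inA t : t \in x |: (y |: A) -> t \notin [set x; y] -> t \in A.
    by rewrite !inE orbA => /orP[->|].
  by apply: tA; exists u, v, w; split=> //; split; apply: inA.
rewrite !cardsU1 !inE (negbTE (cedge_neq xy)) /=.
have -> : (x \in A) = false by apply/negP => /nA[]; rewrite eqxx.
have -> : (y \in A) = false by apply/negP => /nA[]; rewrite eqxx.
by rewrite cR; move: cA; clear; lia.
Qed.

Lemma card_setU_le (A B D : {set T}) : D \subset A :|: B -> #|D| <= #|A| + #|B|.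
Proof. by move=> /subset_leq_card/leq_trans-> //; rewrite cardsU leq_subr. Qed.

Lemma setD1_notin (A : {set C}) i : i \notin A -> A :\ i = A.
Proof. by move=> iA; apply/setDidPl; rewrite disjoint_sym disjoints1. Qed.

(** * Joins and cliques in one color *)

Definition splits i (S : {set T}) := exists A B : {set T},
  [/\ A :|: B = S, A != set0, B != set0 &
      forall a b, a \in A -> b \in B -> cedge i a b].

Definition clique i (Q : {set T}) :=
  forall a b, a \in Q -> b \in Q -> a != b -> cedge i a b.

Lemma has_K4_clique i (S : {set T}) : has_K4 i S ->
  exists Q : {set T}, [/\ Q \subset S, #|Q| = 4 & clique i Q].
Proof.
case=> x [y [z [w [[xS yS zS wS] [xy xz xw yz [yw zw]]]]]].
exists [set u in [:: x; y; z; w]]; split.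
- by apply/subsetP => u; rewrite !inE => /or4P[]/eqP->.
- rewrite cardsE; apply/card_uniqP; rewrite /= !inE !negb_or.
  by rewrite !(cedge_neq xy, cedge_neq xz, cedge_neq xw, cedge_neq yz,
               cedge_neq yw, cedge_neq zw).
- move=> a b; rewrite !inE => /or4P[]/eqP-> /or4P[]/eqP->; rewrite ?eqxx //;
    by rewrite cedgeC.
Qed.

Lemma H2_free_clique i (S Q : {set T}) v a b : H2_free i S ->
  Q \subset S -> #|Q| = 4 -> clique i Q -> v \in S -> v \notin Q ->
  a \in Q -> b \in Q -> a != b -> cedge i v a -> ~ cedge i v b.
Proof.
move=> hS QS Q4 cQ vS vQ aQ bQ ab va vb.
have : 1 < #|Q :\ a :\ b|.
  have := cardsD1 a Q; have := cardsD1 b (Q :\ a).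
  by rewrite !inE aQ bQ eq_sym ab Q4; clear; lia.
case/card_gt1P => z [w []]; rewrite !inE => /and3P[zb za zQ] /and3P[wb wa wQ] zw.
have inS u : u \in Q -> u \in S := subsetP QS u.
have nvQ u : u \in Q -> v != u by move=> uQ; apply: contraNneq vQ => ->.
rewrite !(eq_sym _ a) in za wa; rewrite !(eq_sym _ b) in zb wb.
by apply: (hS a b z w v); try split; auto.
Qed.

(** * Consequences of the induction hypothesis *)

Section InductionStep.
Variables (K L : {set C}) (S : {set T}).
Hypothesis admS : admissible K L S.
Hypothesis IH : forall (K' L' : {set C}) (A : {set T}),
  A \proper S -> admissible K' L' A -> #|A| <= gr_bound #|K'| #|L'|.

Let notL i : i \in K -> i \notin L.
Proof. by case: admS => d _ _ _ iK; rewrite (disjointFr d iK). Qed.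

Let notK i : i \in L -> i \notin K.
Proof. by case: admS => d _ _ _ iL; rewrite (disjointFl d iL). Qed.

Let admA (A : {set T}) : A \proper S -> admissible K L A.
Proof. by move=> /proper_sub AS; apply: admissibleS AS admS. Qed.

(** In the names of these bounds, [K] or [L] is the class of a restricted color. A color of [K], or
    of [L] followed by 0, is absent from [A]; a color of [L] followed by 1 has no triangle in [A]
    and moves to [K]. *)
Lemma bound_K (A : {set T}) i : A \proper S -> i \in K -> ~ has_edge i A ->
  #|A| <= gr_bound #|K :\ i| #|L|.
Proof.
move=> AS iK ni; rewrite -(setD1_notin (notL iK)).
by apply: IH => //; apply: admissible_drop ni; apply: admA.
Qed.

Lemma bound_L0 (A : {set T}) i : A \proper S -> i \in L -> ~ has_edge i A ->
  #|A| <= gr_bound #|K| #|L :\ i|.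
Proof.
move=> AS iL ni; rewrite -(setD1_notin (notK iL)).
by apply: IH => //; apply: admissible_drop ni; apply: admA.
Qed.

Lemma bound_L1 (A : {set T}) i : A \proper S -> i \in L -> ~ has_triangle i A ->
  #|A| <= gr_bound #|K|.+1 #|L :\ i|.
Proof.
move=> AS iL ni; have -> : #|K|.+1 = #|i |: K| by rewrite cardsU1 notK.
by apply: IH => //; apply: admissible_demote ni; apply: admA.
Qed.

Lemma bound_KK (A : {set T}) i j : A \proper S -> i \in K -> j \in K :\ i ->
  ~ has_edge i A -> ~ has_edge j A -> #|A| <= gr_bound #|K :\ i :\ j| #|L|.
Proof.
move=> AS iK /setD1P[ji jK] ni nj; rewrite -(setD1_notin (notL iK)).
have jL : j \notin L :\ i by rewrite !inE (negbTE (notL jK)) andbF.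
rewrite -(setD1_notin jL).
by apply: IH => //; do 2!apply: admissible_drop => //; apply: admA.
Qed.

Lemma bound_KL0 (A : {set T}) i j : A \proper S -> i \in K -> j \in L ->
  ~ has_edge i A -> ~ has_edge j A -> #|A| <= gr_bound #|K :\ i| #|L :\ j|.
Proof.
move=> AS iK jL ni nj.
have jK : j \notin K :\ i by rewrite !inE (negbTE (notK jL)) andbF.
rewrite -(setD1_notin jK) -(setD1_notin (notL iK)).
by apply: IH => //; do 2!apply: admissible_drop => //; apply: admA.
Qed.

Lemma bound_KL1 (A : {set T}) i j : A \proper S -> i \in K -> j \in L ->
  ~ has_edge i A -> ~ has_triangle j A -> #|A| <= gr_bound #|K| #|L :\ j|.
Proof.
move=> AS iK jL ni nj.
have jK : j \notin K :\ i by rewrite !inE (negbTE (notK jL)) andbF.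
have -> : #|K| = #|j |: (K :\ i)| by rewrite cardsU1 jK (cardsD1 i K) iK.
rewrite -(setD1_notin (notL iK)).
apply: IH => //; apply: admissible_demote nj; apply: admissible_drop ni; exact: admA.
Qed.

Lemma bound_L0L0 (A : {set T}) i j : A \proper S -> i \in L -> j \in L :\ i ->
  ~ has_edge i A -> ~ has_edge j A -> #|A| <= gr_bound #|K| #|L :\ i :\ j|.
Proof.
move=> AS iL /setD1P[ji jL] ni nj; rewrite -(setD1_notin (notK iL)).
have jK : j \notin K :\ i by rewrite !inE (negbTE (notK jL)) andbF.
rewrite -(setD1_notin jK).
by apply: IH => //; do 2!apply: admissible_drop => //; apply: admA.
Qed.

Lemma bound_L0L1 (A : {set T}) i j : A \proper S -> i \in L -> j \in L :\ i ->
  ~ has_edge i A -> ~ has_triangle j A ->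
  #|A| <= gr_bound #|K|.+1 #|L :\ i :\ j|.
Proof.
move=> AS iL /setD1P[ji jL] ni nj.
have jK : j \notin K :\ i by rewrite !inE (negbTE (notK jL)) andbF.
have -> : #|K|.+1 = #|j |: (K :\ i)|.
  by rewrite cardsU1 jK (setD1_notin (notK iL)).
apply: IH => //; apply: admissible_demote nj; apply: admissible_drop ni; exact: admA.
Qed.

Lemma bound_L1L1 (A : {set T}) i j : A \proper S -> i \in L -> j \in L :\ i ->
  ~ has_triangle i A -> ~ has_triangle j A ->
  #|A| <= gr_bound #|K|.+2 #|L :\ i :\ j|.
Proof.
move=> AS iL /setD1P[ji jL] ni nj.
have jK : j \notin i |: K by rewrite !inE (negbTE ji) (negbTE (notK jL)).
have -> : #|K|.+2 = #|j |: (i |: K)| by rewrite !cardsU1 jK notK.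
apply: IH => //; do 2!apply: admissible_demote => //; exact: admA.
Qed.

Lemma card_K i : i \in K -> #|K| = #|K :\ i|.+1.
Proof. by move=> iK; rewrite (cardsD1 i) iK. Qed.

Lemma card_L i : i \in L -> #|L| = #|L :\ i|.+1.
Proof. by move=> iL; rewrite (cardsD1 i) iL. Qed.

(** * Sets that split in one color *)

Lemma split_proper (A B : {set T}) i : A :|: B = S -> B != set0 ->
  (forall a b, a \in A -> b \in B -> cedge i a b) -> A \proper S.
Proof.
move=> <- /set0Pn[b bB] AB; apply/properP; split; first exact: subsetUl.
exists b; rewrite ?inE ?bB ?orbT //; apply/negP => bA.
by move: (cedge_neq (AB b b bA bB)); rewrite eqxx.
Qed.

(** An edge of color [i] in one half would form a triangle with any vertex of the other, so [i] is
    absent from both halves. *)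
Lemma splits_K i : i \in K -> splits i S -> #|S| <= gr_bound #|K| #|L|.
Proof.
move=> iK [A [B [AB A0 B0 cAB]]].
have cBA b a : b \in B -> a \in A -> cedge i b a.
  by move=> bB aA; rewrite cedgeC cAB.
have AS := split_proper AB B0 cAB.
have BS : B \proper S by apply: split_proper cBA => //; rewrite setUC.
have [_ _ /(_ i iK) nt _] := admS.
have bA : #|A| <= gr_bound #|K :\ i| #|L|.
  apply: bound_K AS iK _ => -[x [y [xA yA xy]]]; have [b bB] := set0Pn _ B0.
  apply: nt; exists x, y, b; rewrite -AB !inE xA yA bB !orbT.
  by split=> //; split=> //; apply: cAB.
have bB : #|B| <= gr_bound #|K :\ i| #|L|.
  apply: bound_K BS iK _ => -[x [y [xB yB xy]]]; have [a aA] := set0Pn _ A0.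
  apply: nt; exists x, y, a; rewrite -AB !inE xB yB aA !orbT.
  by split=> //; split=> //; apply: cBA.
have := @card_setU_le A B S; rewrite AB subxx => /(_ isT).
by rewrite (card_K iK); have := gr_bound_S #|K :\ i| #|L|; lia.
Qed.

Let in_splitL (A B : {set T}) x : A :|: B = S -> x \in A -> x \in S.
Proof. by move=> <- xA; rewrite inE xA. Qed.

Let in_splitR (A B : {set T}) x : A :|: B = S -> x \in B -> x \in S.
Proof. by move=> <- xA; rewrite inE xA orbT. Qed.

(** Without a triangle of color [i] in [A], the halves sum to at most 1 + 5/2 < 4 times
    [gr_bound #|K| #|L :\ i|]. With one, [B] is a single vertex, since a second would complete H_2,
    and the isolated triangles of [A] are trimmed. *)
Lemma splits_L_edgeless i (A B : {set T}) : i \in L -> A :|: B = S ->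
  A != set0 -> B != set0 -> (forall a b, a \in A -> b \in B -> cedge i a b) ->
  ~ has_edge i B -> #|S| <= gr_bound #|K| #|L|.
Proof.
move=> iL AB A0 B0 cAB nB.
have cBA b a : b \in B -> a \in A -> cedge i b a.
  by move=> bB aA; rewrite cedgeC cAB.
have AS := split_proper AB B0 cAB.
have BS : B \proper S by apply: split_proper cBA => //; rewrite setUC.
have sA x := in_splitL (x := x) AB; have sB x := in_splitR (x := x) AB.
have [_ _ _ /(_ i iL) hS] := admS.
have cS := @card_setU_le A B S; rewrite AB subxx in cS; have {}cS := cS isT.
have := gr_bound_rS #|K| #|L :\ i|; have := gr_bound_S #|K| #|L :\ i|.
have bB := bound_L0 BS iL nB.
rewrite (card_L iL).
case: (classic (has_triangle i A)) => [[x [y [z [[xA yA zA] [xy xz yz]]]]]|nA]; last first.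
  by have := bound_L1 AS iL nA; lia.
move=> _ _; have [b bB'] := set0Pn _ B0.
have B1 : #|B| <= 1.
  apply/card_le1_eqP => d e dB eB; apply/eqP; apply/negPn/negP => de.
  apply: (hS x y z e d); try split; auto; last by rewrite eq_sym.
  exact: cedge_neq (cBA d z dB zA).
(* A triangle of color [i] in [A] forms a K_4 with [b]. A further neighbor of one of its vertices in
   [A] also sees [b], which gives H_2. *)
have [||D [DA tD cD]] := @isolated_triangles_trim #|A| i A.
- by [].
- move=> x' y' z' v' [xA' yA' zA'] vA' [xy' xz' yz'] vy vz vx.
  by apply: (hS x' b y' z' v'); try split; auto.
have DS : D \proper S := sub_proper_trans DA AS.
have := bound_L1 DS iL tD => bD.
have : #|A| < gr_bound #|K| #|L :\ i|.+1.
  apply: gr_bound_isolated_triangles; clear -cD bD; lia.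
by clear -cS B1; lia.
Qed.

(** If both halves contain an edge of color [i], these two edges span a K_4, and any fifth vertex is
    joined to both ends of the edge in the other half. So [S] has at most 4 vertices. *)
Lemma splits_L i : i \in L -> splits i S -> #|S| <= gr_bound #|K| #|L|.
Proof.
move=> iL [A [B [AB A0 B0 cAB]]].
have cBA b a : b \in B -> a \in A -> cedge i b a.
  by move=> bB aA; rewrite cedgeC cAB.
case: (classic (has_edge i B)) => [[b [b' [bB bB' bb']]]|nB]; last first.
  exact: (splits_L_edgeless iL AB A0 B0 cAB nB).
case: (classic (has_edge i A)) => [[a [a' [aA aA' aa']]]|nA]; last first.
  by apply: (splits_L_edgeless iL _ B0 A0 cBA nA); rewrite setUC.
have sA x := in_splitL (x := x) AB; have sB x := in_splitR (x := x) AB.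
have [_ _ _ /(_ i iL) hS] := admS.
have S4 : #|S| <= size [:: a; a'; b; b'].
  apply: leq_trans (card_size _); apply: subset_leq_card; apply/subsetP => v vS.
  apply/negPn/negP; rewrite !inE !negb_or => /and4P[va va' vb vb'].
  move: (vS); rewrite -AB => /setUP[vA|vB].
    by apply: (hS b b' a a' v); try split; auto.
  by apply: (hS a a' b b' v); try split; auto.
rewrite (card_L iL); have [h _] := gr_bound_rS #|K| #|L :\ i|.
have := gr_bound_gt0 #|K| #|L :\ i|; move: S4 h => /=; clear; lia.
Qed.

(** * Parts and neighborhoods in sets that no color splits *)

Definition reduced f p q :=
  gallai_partition S f p q /\ forall i, ~ splits i S.

Lemma reducedC f p q : reduced f p q -> reduced f q p.
Proof.
move=> [[fS ff fne fc] ns]; split=> //; split=> // x y xS yS fxy.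
by have [-> [|]] := fc x y xS yS fxy; split=> //; [right|left].
Qed.

Section Parts.
Variables (f : T -> T) (p q : C).
Hypothesis red : reduced f p q.

Definition part x := [set y in S | f y == f x].
(** For a Gallai partition, this is the union of the parts joined to the part of [x] in color
    [i]. *)
Definition outer i x := [set y in S | (f y != f x) && (c x y == i)].

Lemma part_id x : x \in S -> x \in part x.
Proof. by rewrite inE eqxx andbT. Qed.

Lemma part_sub x y : y \in part x -> y \in S.
Proof. by rewrite inE => /andP[]. Qed.

Lemma outer_sub i x y : y \in outer i x -> y \in S.
Proof. by rewrite inE => /andP[]. Qed.

Lemma part_outer i x y z : x \in S -> y \in part x -> z \in outer i x -> cedge i y z.
Proof.
case: red => -[_ _ _ fc] _ xS; rewrite !inE.
move=> /andP[yS /eqP yx] /andP[zS /andP[zx /eqP <-]].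
have fxz : f x != f z by rewrite eq_sym.
have [xz _] := fc x z xS zS fxz.
have fyz : f y != f z by rewrite yx.
have [yz _] := fc y z yS zS fyz.
rewrite /cedge xz yz yx eqxx andbT.
by apply: contraNneq zx => <-; rewrite yx.
Qed.

Lemma outer_proper i x : x \in S -> outer i x \proper S.
Proof.
move=> xS; apply/properP; split; first by apply/subsetP => y; exact: outer_sub.
by exists x => //; rewrite inE eqxx andbF.
Qed.

Lemma part_outer_cover x : x \in S -> S \subset part x :|: outer p x :|: outer q x.
Proof.
case: red => -[_ _ _ fc] _ xS; apply/subsetP => y yS; rewrite !inE yS /=.
case: eqVneq => //= yx; rewrite eq_sym in yx.
by have [_ [->|->]] := fc x y xS yS yx; rewrite eqxx ?orbT.
Qed.

Lemma card_part_outer x : x \in S ->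
  #|S| <= #|part x| + #|outer p x| + #|outer q x|.
Proof.
move=> xS; have := card_setU_le (part_outer_cover xS).
by have := @card_setU_le (part x) (outer p x) _ (subxx _); lia.
Qed.

Lemma part_proper x : x \in S -> part x \proper S.
Proof.
case: red => -[_ _ [u [v [uS vS uv]]] _] _ xS; apply/properP; split.
  by apply/subsetP => y; exact: part_sub.
case: (eqVneq (f u) (f x)) => ux.
  by exists v => //; rewrite inE -ux eq_sym (negbTE uv) andbF.
by exists u => //; rewrite inE (negbTE ux) andbF.
Qed.

(** Otherwise the part of [x] is joined to the rest in color [q], which then splits [S]. *)
Lemma outer_neq0 x : x \in S -> exists y, y \in outer p x.
Proof.
move=> xS; apply/set0Pn/negP => /eqP p0.
have cov := part_outer_cover xS; rewrite p0 setU0 in cov.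
case: red => _ /(_ q); apply; exists (part x), (outer q x); split.
- apply/eqP; rewrite eqEsubset cov andbT; apply/subsetP => y /setUP[].
    exact: part_sub.
  exact: outer_sub.
- by apply/set0Pn; exists x; exact: part_id.
- have /properP[_ [y yS yx]] := part_proper xS.
  by apply/set0Pn; exists y; case/setUP: (subsetP cov y yS) => //; rewrite (negbTE yx).
- by move=> a b; exact: part_outer.
Qed.

Lemma part_edge_triangle x : x \in S -> has_edge p (part x) -> has_triangle p S.
Proof.
move=> xS [y [z [yX zX yz]]]; have [u uN] := outer_neq0 xS.
exists y, z, u; split; first by rewrite (part_sub yX) (part_sub zX) (outer_sub uN).
by rewrite yz !(part_outer xS _ uN).
Qed.

Lemma outer_edge_K4 x : x \in S -> has_edge p (part x) ->
  has_edge p (outer p x) -> has_K4 p S.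
Proof.
move=> xS [y [z [yX zX yz]]] [u [v [uN vN uv]]].
exists y, z, u, v; split.
  by rewrite (part_sub yX) (part_sub zX) (outer_sub uN) (outer_sub vN).
by rewrite yz uv !(part_outer xS _ uN) ?(part_outer xS _ vN).
Qed.

Definition reps := f @: S.

Lemma reps_sub : reps \subset S.
Proof. by case: red => -[fS _ _ _] _; apply/subsetP => y /imsetP[x xS ->]; exact: fS. Qed.

Lemma reps_two_colored : two_colored p q reps.
Proof.
case: red => -[fS ff _ fc] _ y z /imsetP[u uS ->] /imsetP[v vS ->] uv.
have fuv : f (f u) != f (f v) by rewrite !ff.
by case: (fc _ _ (fS u uS) (fS v vS) fuv).
Qed.

Lemma card_reps m : (forall x, x \in S -> #|part x| <= m) -> #|S| <= #|reps| * m.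
Proof.
move=> hm; rewrite -sum1_card (partition_big_imset f) -sum_nat_const.
by apply: leq_sum => y /imsetP[x xS ->]; rewrite sum1dep_card hm.
Qed.

Lemma reduced_neq : p != q.
Proof.
case: red => -[_ _ [u [_ [uS _ _]]] _] ns.
have [y yp] := outer_neq0 uS.
apply/negP => /eqP pq; apply: (ns p); exists (part u), (outer p u); split.
- apply/eqP; rewrite eqEsubset; apply/andP; split.
    by apply/subsetP => z /setUP[]; [exact: part_sub|exact: outer_sub].
  by have := part_outer_cover uS; rewrite -pq -setUA setUid.
- by apply/set0Pn; exists u; exact: part_id.
- by apply/set0Pn; exists y.
- by move=> a b; exact: part_outer.
Qed.

(* A vertex outside the clique [Q] cannot share its part with a vertex of [Q],
   for it would then see the at least two vertices of [Q] in other parts in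
   color [q]. *)
Lemma crossing_K4 : q \in L -> (forall x, x \in S -> ~ has_triangle q (part x)) ->
  has_K4 q S -> exists Q : {set T}, [/\ Q \subset S, #|Q| = 4, clique q Q &
    forall v, v \in S :\: Q -> exists d, forall a, a \in Q -> a != d -> cedge p v a].
Proof.
move=> qL nt /has_K4_clique[Q [QS Q4 cQ]]; exists Q; split=> // v /setDP[vS vQ].
have [_ _ _ /(_ q qL) hS] := admS; case: red => -[_ _ _ fc] _.
have H2 := H2_free_clique hS QS Q4 cQ vS vQ.
have far a : a \in Q -> f v != f a.
  move=> aQ; apply/eqP => va; have aS := subsetP QS a aQ.
  (* Three vertices of [Q] in one part would form a triangle of color [q] there. *)
  have : #|Q :&: part a| <= 2.
    rewrite leqNgt; apply/negP => /card_gt2P[x [y [z [[]]]]].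
    move=> /setIP[xQ xa] /setIP[yQ ya] /setIP[zQ za] [xy yz zx].
    apply: (nt a aS); exists x, y, z; split=> //.
    by split; apply: cQ => //; rewrite eq_sym.
  have := cardsID (part a) Q; rewrite Q4 => cI I2.
  have : 1 < #|Q :\: part a| by move: cI I2; clear; lia.
  case/card_gt1P => b [d []]; rewrite !inE.
  move=> /andP[ba bQ] /andP[da dQ] bd.
  have see u : u \in Q -> ~~ ((u \in S) && (f u == f a)) -> cedge q v u.
    move=> uQ; have uS := subsetP QS u uQ; rewrite uS /= eq_sym => ua.
    have ua' : f v != f u by rewrite va.
    rewrite /cedge (fc v u vS uS ua').1 va -(fc a u aS uS ua).1.
    rewrite (cedge_eq (cQ a u aQ uQ _)) ?eqxx ?andbT; last first.
      by apply: contraNneq ua => ->.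
    by apply: contraNneq ua' => ->.
  exact: (H2 b d bQ dQ bd (see b bQ ba) (see d dQ da)).
have pq a : a \in Q -> cedge p v a \/ cedge q v a.
  move=> aQ; have aS := subsetP QS a aQ; have va := far a aQ.
  have nva : v != a by apply: contraNneq va => ->.
  by have [_ [<-|<-]] := fc v a vS aS va; [left|right]; apply: cedgeI.
case: (classic (exists2 d, d \in Q & cedge q v d)) => [[d dQ vd]|nd].
  exists d => a aQ ad; case: (pq a aQ) => // va.
  by case: (H2 a d aQ dQ ad va vd).
(* Here no vertex of [Q] is exceptional; [v], which lies outside [Q], is a dummy value. *)
by exists v => a aQ _; case: (pq a aQ) => // va; case: nd; exists a.
Qed.

Lemma setD_clique_proper (Q : {set T}) : Q \subset S -> #|Q| = 4 -> S :\: Q \proper S.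
Proof.
move=> QS Q4; have /card_gt0P[a aQ] : 0 < #|Q| by rewrite Q4.
apply/properP; split; first exact: subsetDl.
by exists a; rewrite ?(subsetP QS) // inE aQ.
Qed.

Lemma card_setD_clique (Q : {set T}) : Q \subset S -> #|Q| = 4 -> #|S| = #|S :\: Q| + 4.
Proof. by move=> QS Q4; rewrite -(cardsID Q S) (setIidPr QS) Q4 addnC. Qed.

(** Two vertices outside [Q] each miss at most one vertex of [Q] in color [p], so they have a common
    neighbor in [Q], and an edge of color [p] between them would close a triangle. The factor 2
    gained by losing [p] absorbs the 4 vertices of [Q]. *)
Lemma crossing_K4_K : p \in K -> q \in L ->
  (forall x, x \in S -> ~ has_triangle q (part x)) ->
  has_K4 q S -> #|S| <= gr_bound #|K| #|L|.
Proof.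
move=> pK qL nt /(crossing_K4 qL nt)[Q [QS Q4 cQ hQ]].
have [_ _ /(_ p pK) tS _] := admS.
have nW : ~ has_edge p (S :\: Q).
  case=> u [v [uW vW uv]]; have [d ud] := hQ u uW; have [e ve] := hQ v vW.
  have : 0 < #|Q :\ d :\ e|.
    have := cardsD1 d Q; have := cardsD1 e (Q :\ d); rewrite Q4.
    by case: (_ \in _); case: (_ \in _); clear; lia.
  case/card_gt0P => a; rewrite !inE => /and3P[ae ad aQ].
  apply: tS; exists u, v, a; split; last by split; [|exact: ud|exact: ve].
  by split; [case/setDP: uW|case/setDP: vW|exact: (subsetP QS)].
have bW := bound_K (setD_clique_proper QS Q4) pK nW.
have := card_setD_clique QS Q4; rewrite (card_L qL) in bW; rewrite (card_K pK) (card_L qL).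
have [+ _] := gr_bound_S #|K :\ p| #|L :\ q|.+1.
have [+ _] := gr_bound_rS #|K :\ p| #|L :\ q|.
by have := gr_bound_gt0 #|K :\ p| #|L :\ q|; move: bW; clear; lia.
Qed.

(** Given a triangle of color [p] outside [Q], some vertex of [Q] sees all of it and another sees
    two of its vertices, which is H_2. So [p] becomes a triangle color outside [Q], and 5/2 * 17/4 +
    4 < 17. *)
Lemma crossing_K4_L : p \in L :\ q -> q \in L ->
  (forall x, x \in S -> ~ has_triangle q (part x)) ->
  has_K4 q S -> #|S| <= gr_bound #|K| #|L|.
Proof.
move=> pLq qL nt /(crossing_K4 qL nt)[Q [QS Q4 cQ hQ]].
have /setD1P[pq pL] := pLq.
have [_ _ _ /(_ p pL) hS] := admS.
have nW : ~ has_triangle p (S :\: Q).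
  case=> x [y [z [[xW yW zW] [xy xz yz]]]].
  have [d1 xd] := hQ x xW; have [d2 yd] := hQ y yW; have [d3 zd] := hQ z zW.
  have inS u : u \in S :\: Q -> u \in S by case/setDP.
  have inSQ u : u \in Q -> u \in S := subsetP QS u.
  have sep u v : u \in Q -> v \in S :\: Q -> u != v.
    by move=> uQ; apply: contraTneq => <-; rewrite inE uQ.
  have no a b : a \in Q -> b \in Q -> a != d1 -> a != d2 -> a != d3 ->
      b != d1 -> b != d2 -> b != a -> False.
    move=> aQ bQ a1 a2 a3 b1 b2 ab.
    have bx : cedge p b x by rewrite cedgeC xd.
    have yb : cedge p b y by rewrite cedgeC yd.
    by apply: (hS x y z a b); try split; auto.
  have : 1 < #|Q :\ d1 :\ d2|.
    have := cardsD1 d1 Q; have := cardsD1 d2 (Q :\ d1); rewrite Q4.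
    by case: (_ \in _); case: (_ \in _); clear; lia.
  case/card_gt1P => a [b []]; rewrite !inE.
  move=> /and3P[a2 a1 aQ] /and3P[b2 b1 bQ] ab.
  (* At most one of [a] and [b] is the vertex missed by [z]; the other completes the K_4. *)
  case: (eqVneq a d3) => [ad|ad]; last by apply: (no a b); rewrite // eq_sym.
  by apply: (no b a) => //; rewrite -ad eq_sym.
have bW := bound_L1 (setD_clique_proper QS Q4) pL nW.
have := card_setD_clique QS Q4.
have qLp : q \in L :\ p by rewrite !inE eq_sym pq.
have eLp : #|L :\ p| = #|L :\ p :\ q|.+1 by rewrite (cardsD1 q (L :\ p)) qLp.
rewrite eLp in bW; rewrite (card_L pL) eLp gr_bound_rSS.
have [_ h1] := gr_bound_S #|K| #|L :\ p :\ q|.+1.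
have [_ h2] := gr_bound_rS #|K| #|L :\ p :\ q|.
by have := gr_bound_gt0 #|K| #|L :\ p :\ q|; move: bW h1 h2; clear; lia.
Qed.

(** The triangle and one outer vertex form a K_4, to which a second outer vertex would send three
    edges. *)
Lemma part_triangle_outer x : p \in L -> x \in S -> has_triangle p (part x) ->
  #|outer p x| <= 1.
Proof.
move=> pL xS [y [z [w [[yX zX wX] [yz yw zw]]]]].
have [_ _ _ /(_ p pL) hS] := admS.
apply/card_le1_eqP => u v uN vN; apply/eqP; apply/negPn/negP => uv.
have sub t : t \in part x -> t \in S by exact: part_sub.
have subN t : t \in outer p x -> t \in S by exact: outer_sub.
have e a b : a \in part x -> b \in outer p x -> cedge p a b by exact: part_outer.
have e' a b : a \in part x -> b \in outer p x -> cedge p b a.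
  by move=> aX bN; rewrite cedgeC e.
apply: (hS y z w v u); try split; auto; last by rewrite eq_sym.
exact: cedge_neq (e' w u wX uN).
Qed.

Lemma outer_edge i x : x \in S -> has_edge i (outer i x) -> has_triangle i S.
Proof.
move=> xS [y [z [yN zN yz]]]; exists x, y, z; split.
  by rewrite xS (outer_sub yN) (outer_sub zN).
by rewrite yz !(part_outer xS (part_id xS)).
Qed.

Lemma outer_triangle i x : x \in S -> has_triangle i (outer i x) -> has_K4 i S.
Proof.
move=> xS [y [z [w [[yN zN wN] [yz yw zw]]]]]; exists x, y, z, w; split.
  by rewrite xS (outer_sub yN) (outer_sub zN) (outer_sub wN).
by rewrite yz yw zw !(part_outer xS (part_id xS)).
Qed.

(* The parts of a set without edges of color [p] are completely joined in color
   [q], so that at most one of two parts contains an edge of color [q]. *)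
Lemma bound_edgeless (A : {set T}) : p \in L -> q \in L :\ p -> A \proper S ->
  ~ has_edge p A -> ~ has_K4 q S -> (forall x, x \in S -> ~ has_triangle q (part x)) ->
  #|A| <= gr_bound #|K|.+1 #|L :\ p :\ q| + gr_bound #|K| #|L :\ p :\ q|.
Proof.
move=> pL qL AS np nK nt; case: (set_0Vmem A) => [->|[y yA]]; first by rewrite cards0.
have sA u : u \in A -> u \in S by apply/subsetP/proper_sub.
pose Y := A :&: part y; pose Z := A :\: part y.
have YZ u v : u \in Y -> v \in Z -> cedge q u v.
  case: red => -[_ _ _ fc] _; rewrite !inE => /andP[uA /andP[_ /eqP uy]].
  case/andP=> + vA; rewrite sA //= => vy.
  have fuv : f u != f v by rewrite uy eq_sym.
  have uv : u != v by apply: contraNneq fuv => ->.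
  have [_ [e|<-]] := fc u v (sA u uA) (sA v vA) fuv; last exact: cedgeI.
  by case: np; exists u, v; split=> //; rewrite -e cedgeI.
have sY u : u \in Y -> u \in A by case/setIP.
have sZ u : u \in Z -> u \in A by case/setDP.
have yY : y \in Y by rewrite inE yA part_id ?sA.
have YS : Y \proper S by apply: sub_proper_trans AS; apply: subsetIl.
have ZS : Z \proper S by apply: sub_proper_trans AS; apply: subsetDl.
have npY : ~ has_edge p Y by move=> h; apply: np; apply: has_edgeS h; apply: subsetIl.
have npZ : ~ has_edge p Z by move=> h; apply: np; apply: has_edgeS h; apply: subsetDl.
have ntY : ~ has_triangle q Y.
  by move=> h; apply: (nt y (sA y yA)); apply: has_triangleS h; apply: subsetIr.
have ntZ : ~ has_triangle q Z.
  case=> a [b [d [[aZ bZ dZ] [ab ad bd]]]]; apply: nK; exists y, a, b, d.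
  by split; [split; auto|rewrite ab ad bd !YZ].
have := @card_setU_le Y Z A; rewrite setID subxx => /(_ isT).
case: (classic (has_edge q Y)) => [[a [b [aY bY ab]]]|nY].
  case: (classic (has_edge q Z)) => [[d [e [dZ eZ de]]]|nZ].
    case: nK; exists a, b, d, e.
    by split; [split; auto|rewrite ab de !YZ].
  have := bound_L0L1 YS pL qL npY ntY; have := bound_L0L0 ZS pL qL npZ nZ.
  by clear; lia.
have := bound_L0L1 ZS pL qL npZ ntZ; have := bound_L0L0 YS pL qL npY nY.
by clear; lia.
Qed.
End Parts.

(** * Cases according to the classes of the two colors between parts *)

Lemma bound_KK_case f p q : reduced f p q -> p \in K -> q \in K ->
  #|S| <= gr_bound #|K| #|L|.
Proof.
move=> red pK qK; have [_ _ tS _] := admS; have red' := reducedC red.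
have qKp : q \in K :\ p by rewrite !inE eq_sym (reduced_neq red).
have := card_reps (f := f) (m := gr_bound #|K :\ p :\ q| #|L|).
(* An edge of color [p] or [q] in a part would form a triangle with a neighbor of the part in that
   color. *)
have part_le x : x \in S -> #|part f x| <= gr_bound #|K :\ p :\ q| #|L|.
  move=> xS; apply: (bound_KK (part_proper red xS) pK qKp) => h.
    by apply: (tS p pK); apply: (part_edge_triangle red xS h).
  by apply: (tS q qK); apply: (part_edge_triangle red' xS h).
move=> /(_ part_le) /leq_trans-> //.
have eK : #|K| = #|K :\ p :\ q|.+2.
  by rewrite (card_K pK) (cardsD1 q (K :\ p)) qKp.
rewrite eK gr_bound_SS leq_mul2r; apply/orP; right.
have RS := reps_sub red; apply: (ramsey_3_3 (reps_two_colored red)) => h.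
  by apply: (tS p pK); apply: has_triangleS h.
by apply: (tS q qK); apply: has_triangleS h.
Qed.

(** The part and its at most one neighbor in color [q] together contain no edge of color [p], nor
    does the neighborhood in color [p]. Two sets without [p] fit into the factor 2. *)
Lemma bound_KL_triangle f p q x : reduced f p q -> p \in K -> q \in L ->
  x \in S -> has_triangle q (part f x) -> #|S| <= gr_bound #|K| #|L|.
Proof.
move=> red pK qL xS tX; have [_ _ tS _] := admS; have red' := reducedC red.
have /card_le1_eqP o1 := part_triangle_outer red' qL xS tX.
have pq := reduced_neq red.
have nX y z : y \in part f x -> z \in part f x -> ~ cedge p y z.
  move=> yX zX yz; apply: (tS p pK); apply: (part_edge_triangle red xS).
  by exists y, z.
have nXN y z : y \in part f x -> z \in outer f q x -> ~ cedge p y z.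
  move=> yX zN /cedge_eq yz; move: (cedge_eq (part_outer red' xS yX zN)).
  by rewrite yz => e; rewrite e eqxx in pq.
have np : ~ has_edge p (part f x :|: outer f q x).
  case=> y [z [/setUP[yX|yN] /setUP[zX|zN] yz]].
  - exact: (nX y z).
  - exact: (nXN y z).
  - by apply: (nXN z y) => //; rewrite cedgeC.
  - by move: (cedge_neq yz); rewrite (o1 y z) ?eqxx.
have US : part f x :|: outer f q x \proper S.
  apply/properP; split.
    by apply/subsetP => y /setUP[]; [exact: part_sub|exact: outer_sub].
  have [y yN] := outer_neq0 red xS; exists y; first exact: outer_sub yN.
  move: yN; rewrite !inE => /andP[yS /andP[yx /eqP->]].
  by rewrite yS (negbTE yx) (negbTE pq).
have nN : ~ has_edge p (outer f p x).
  by move=> h; apply: (tS p pK); apply: (outer_edge red xS h).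
have := bound_K US pK np; have := bound_K (outer_proper f p xS) pK nN.
have := part_outer_cover red xS; rewrite setUAC => /card_setU_le.
rewrite (card_K pK); have [+ _] := gr_bound_S #|K :\ p| #|L|.
clear; lia.
Qed.

Lemma bound_KL_case f p q : reduced f p q -> p \in K -> q \in L ->
  #|S| <= gr_bound #|K| #|L|.
Proof.
move=> red pK qL; have [_ _ tS _] := admS; have red' := reducedC red.
case: (classic (exists2 x, x \in S & has_triangle q (part f x))) => [[x]|nt'].
  exact: (bound_KL_triangle red pK qL).
have nt x : x \in S -> ~ has_triangle q (part f x).
  by move=> xS h; apply: nt'; exists x.
case: (classic (has_K4 q S)) => [|nK4]; first exact: (crossing_K4_K red).
have np x : x \in S -> ~ has_edge p (part f x).
  by move=> xS h; apply: (tS p pK); apply: (part_edge_triangle red xS h).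
(* The part and its neighborhood in color [q] take at most a quarter of the bound each, the
   neighborhood in color [p] at most a half. *)
case: (classic (exists2 x, x \in S & has_edge q (part f x))) => [[x xS qX]|nq'].
  have nN : ~ has_edge p (outer f p x).
    by move=> h; apply: (tS p pK); apply: (outer_edge red xS h).
  have nNq : ~ has_edge q (outer f q x).
    by move=> h; apply: nK4; apply: (outer_edge_K4 red' xS).
  have := card_part_outer red xS.
  have := bound_KL1 (part_proper red xS) pK qL (np x xS) (nt x xS).
  have := bound_L0 (outer_proper f q xS) qL nNq.
  have := bound_K (outer_proper f p xS) pK nN.
  rewrite (card_K pK) (card_L qL).
  have [+ _] := gr_bound_S #|K :\ p| #|L :\ q|.+1.
  have [+ _] := gr_bound_rS #|K :\ p|.+1 #|L :\ q|.
  by clear; lia.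
have part_le x : x \in S -> #|part f x| <= gr_bound #|K :\ p| #|L :\ q|.
  move=> xS; apply: (bound_KL0 (part_proper red xS) pK qL (np x xS)) => h.
  by apply: nq'; exists x.
have := card_reps part_le; have RS := reps_sub red.
have : #|reps f| <= 8.
  apply: (ramsey_3_4 (reps_two_colored red)) => h.
    by apply: (tS p pK); apply: has_triangleS h.
  by apply: nK4; apply: has_K4S h.
rewrite -(leq_pmul2r (gr_bound_gt0 #|K :\ p| #|L :\ q|)).
rewrite (card_K pK) (card_L qL).
have [+ _] := gr_bound_S #|K :\ p| #|L :\ q|.+1.
have [+ _] := gr_bound_rS #|K :\ p| #|L :\ q|.
by clear; lia.
Qed.

(** At most one vertex is joined to the part in color [p]. Of the part and its neighborhood in color
    [q], one has no edge and the other no triangle of color [q], and (1 + 5/2) * 17/4 + 1 < 17. *)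
Lemma bound_LL_triangle f p q x : reduced f p q -> p \in L -> q \in L ->
  x \in S -> has_triangle p (part f x) -> #|S| <= gr_bound #|K| #|L|.
Proof.
move=> red pL qL xS tX; have red' := reducedC red.
have o1 := part_triangle_outer red pL xS tX.
have pq := reduced_neq red.
have [_ _ _ /(_ q qL) hS] := admS.
have [a [b [d [[aX bX dX] [ab ad bd]]]]] := tX.
have sub t : t \in part f x -> t \in S by exact: part_sub.
have subN t : t \in outer f q x -> t \in S by exact: outer_sub.
have e u v : u \in part f x -> v \in outer f q x -> cedge q u v.
  exact: (part_outer red').
have e' u v : u \in part f x -> v \in outer f q x -> cedge q v u.
  by move=> uX vN; rewrite cedgeC e.
have fin : #|part f x| + #|outer f q x| <=
    gr_bound #|K|.+1 #|L :\ q| + gr_bound #|K| #|L :\ q| ->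
    #|S| <= gr_bound #|K| #|L|.
  have := card_part_outer red xS.
  have pLq : p \in L :\ q by rewrite !inE pq.
  have eLq : #|L :\ q| = #|L :\ q :\ p|.+1 by rewrite (cardsD1 p (L :\ q)) pLq.
  rewrite (card_L qL) eLq gr_bound_rSS.
  have := gr_bound_gt0 #|K| #|L :\ q :\ p|.
  have [_ +] := gr_bound_S #|K| #|L :\ q :\ p|.+1.
  have [_ +] := gr_bound_rS #|K| #|L :\ q :\ p|.
  by move: o1; clear; lia.
have XS := part_proper red xS; have NS := outer_proper f q xS.
case: (classic (has_edge q (part f x))) => [[y [z [yX zX yz]]]|nX]; last first.
  apply: fin; have := bound_L0 XS qL nX.
  suff nN : ~ has_triangle q (outer f q x) by have := bound_L1 NS qL nN; clear; lia.
  case=> u [v [w [[uN vN wN] [uv uw vw]]]].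
  have ba : b != a by rewrite eq_sym (cedge_neq ab).
  have bw := cedge_neq (e b w bX wN).
  by apply: (hS u v w a b); try split; auto.
have nN : ~ has_edge q (outer f q x).
  case=> u [v [uN vN uv]].
  have [t tX' /andP[ty tz]] : exists2 t, t \in part f x & (t != y) && (t != z).
    have : 2 < #|part f x|.
      apply/card_gt2P; exists a, b, d; split=> //.
      by rewrite (cedge_neq ab) (cedge_neq bd) eq_sym (cedge_neq ad).
    rewrite (cardsD1 y) yX (cardsD1 z) in_setD1 zX eq_sym (cedge_neq yz) /=.
    rewrite !add1n !ltnS => /card_gt0P[t]; rewrite !in_setD1.
    by case/and3P => tz ty tX'; exists t; rewrite ?ty.
  by apply: (hS u v y z t); try split; auto.
apply: fin; have := bound_L0 NS qL nN.
suff nt : ~ has_triangle q (part f x) by have := bound_L1 XS qL nt; clear; lia.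
(* With triangles of both colors, [S] is the part and two vertices [u], [v]. The color of [uv] then
   joins one of them to everything else and splits [S]. *)
move=> tqX; have o2 := part_triangle_outer red' qL xS tqX.
have [u uN] := outer_neq0 red xS; have [v vN] := outer_neq0 red' xS.
have oneu w : w \in outer f p x -> w = u.
  by move=> wN; apply: (card_le1_eqP o1).
have onev w : w \in outer f q x -> w = v.
  by move=> wN; apply: (card_le1_eqP o2).
have cov := part_outer_cover red xS.
have eS : S = part f x :|: outer f p x :|: outer f q x.
  apply/eqP; rewrite eqEsubset cov /=; apply/subsetP => w.
  by case/setUP => [/setUP[]|]; [exact: part_sub|exact: outer_sub|exact: outer_sub].
have [[_ _ _ fc] ns] := red.
have uv : u != v.
  apply: contraNneq pq => uv; move: uN vN; rewrite uv !inE.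
  by move=> /and3P[_ _ /eqP<-] /and3P[_ _ /eqP<-].
have fuv : f u != f v.
  apply: contraNneq pq => fuv; move: uN vN; rewrite !inE.
  move=> /and3P[uS ux /eqP<-] /and3P[vS vx /eqP<-].
  rewrite !(eq_sym _ (f x)) in ux vx.
  by rewrite (fc x u xS uS ux).1 (fc x v xS vS vx).1 fuv.
have [_ [cuv|cuv]] := fc u v (outer_sub uN) (outer_sub vN) fuv.
  apply: (ns p); exists (part f x :|: outer f q x), (outer f p x); split.
  - by rewrite setUAC -eS.
  - by apply/set0Pn; exists x; rewrite inE part_id.
  - by apply/set0Pn; exists u.
  - move=> y' z' /setUP[yX'|/onev->] zN'; first exact: (part_outer red xS yX' zN').
    by rewrite (oneu z' zN') -cuv cedgeC cedgeI.
apply: (ns q); exists (part f x :|: outer f p x), (outer f q x); split.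
- by rewrite -eS.
- by apply/set0Pn; exists x; rewrite inE part_id.
- by apply/set0Pn; exists v.
- move=> y' z' /setUP[yX'|/oneu->] zN'; first exact: e.
  by rewrite (onev z' zN') -cuv cedgeI.
Qed.

(** In units of [gr_bound #|K| #|L :\ p :\ q|]: if the part also contains color [q], the sum is at
    most 5 + 17/4 + 17/4 < 17. If not, it is at most 5/2 + 85/8 + 7/2 < 17, where 7/2 is due to
    [bound_edgeless]; the plain bound 17/4 would exceed 17. *)
Lemma bound_LL_edge f p q x : reduced f p q -> p \in L -> q \in L ->
  (forall x, x \in S -> ~ has_triangle p (part f x) /\ ~ has_triangle q (part f x)) ->
  ~ has_K4 p S -> ~ has_K4 q S ->
  x \in S -> has_edge p (part f x) -> #|S| <= gr_bound #|K| #|L|.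
Proof.
move=> red pL qL nt np nq xS pX; have red' := reducedC red.
have pq := reduced_neq red.
have qLp : q \in L :\ p by rewrite !inE eq_sym pq.
have pLq : p \in L :\ q by rewrite !inE pq.
have eLp : #|L :\ p| = #|L :\ p :\ q|.+1 by rewrite (cardsD1 q (L :\ p)) qLp.
have eqp : L :\ q :\ p = L :\ p :\ q by rewrite !setDDl setUC.
have eLq : #|L :\ q| = #|L :\ p :\ q|.+1 by rewrite (cardsD1 p (L :\ q)) pLq eqp.
have nN : ~ has_edge p (outer f p x).
  by move=> h; apply: np; apply: (outer_edge_K4 red xS pX).
have XS := part_proper red xS; have NS i := outer_proper f i xS.
have := card_part_outer red xS; rewrite (card_L pL) eLp gr_bound_rSS.
have := gr_bound_gt0 #|K| #|L :\ p :\ q|.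
have [_ +] := gr_bound_S #|K| #|L :\ p :\ q|.+1.
have [_ +] := gr_bound_S #|K| #|L :\ p :\ q|.
have [_ +] := gr_bound_rS #|K| #|L :\ p :\ q|.
have [ntp ntq] := nt x xS.
case: (classic (has_edge q (part f x))) => [qX|nX].
  have nNq : ~ has_edge q (outer f q x).
    by move=> h; apply: nq; apply: (outer_edge_K4 red' xS qX).
  have := bound_L0 (NS p) pL nN; have := bound_L0 (NS q) qL nNq.
  have := bound_L1L1 XS pL qLp ntp ntq; rewrite eLp eLq gr_bound_SS.
  by clear; lia.
have nNq : ~ has_triangle q (outer f q x).
  by move=> h; apply: nq; apply: (outer_triangle red' xS h).
have := bound_L0L1 XS qL pLq nX ntp.
have := bound_L1 (NS q) qL nNq.
have := bound_edgeless red pL qLp (NS p) nN nq (fun x xS => (nt x xS).2).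
by rewrite eLq eqp; clear; lia.
Qed.

Lemma bound_LL_case f p q : reduced f p q -> p \in L -> q \in L ->
  #|S| <= gr_bound #|K| #|L|.
Proof.
move=> red pL qL; have red' := reducedC red; have pq := reduced_neq red.
have qLp : q \in L :\ p by rewrite !inE eq_sym pq.
have pLq : p \in L :\ q by rewrite !inE pq.
case: (classic (exists2 x, x \in S & has_triangle p (part f x))) => [[x]|ntp].
  exact: (bound_LL_triangle red).
case: (classic (exists2 x, x \in S & has_triangle q (part f x))) => [[x]|ntq].
  exact: (bound_LL_triangle red').
have nt x : x \in S -> ~ has_triangle p (part f x) /\ ~ has_triangle q (part f x).
  by move=> xS; split=> h; [apply: ntp|apply: ntq]; exists x.
case: (classic (has_K4 p S)) => [|nKp].
  by apply: (crossing_K4_L red' qLp pL) => x xS; apply: (nt x xS).1.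
case: (classic (has_K4 q S)) => [|nKq].
  by apply: (crossing_K4_L red pLq qL) => x xS; apply: (nt x xS).2.
case: (classic (exists2 x, x \in S & has_edge p (part f x))) => [[x]|nep].
  exact: (bound_LL_edge red).
case: (classic (exists2 x, x \in S & has_edge q (part f x))) => [[x]|neq].
  by apply: (bound_LL_edge red') => // y yS; case: (nt y yS).
have part_le x : x \in S -> #|part f x| <= gr_bound #|K| #|L :\ p :\ q|.
  move=> xS; apply: (bound_L0L0 (part_proper red xS) pL qLp) => h.
    by apply: nep; exists x.
  by apply: neq; exists x.
have := card_reps part_le => /leq_trans-> //.
have eL : #|L| = #|L :\ p :\ q|.+2.
  by rewrite (card_L pL) (cardsD1 q (L :\ p)) qLp.
rewrite eL gr_bound_rSS leq_mul2r; apply/orP; right.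
have RS := reps_sub red; apply: (ramsey_4_4 (reps_two_colored red)) => h.
  by apply: nKp; apply: has_K4S h.
by apply: nKq; apply: has_K4S h.
Qed.
End InductionStep.

Theorem admissible_bound (K L : {set C}) (S : {set T}) :
  admissible K L S -> #|S| <= gr_bound #|K| #|L|.
Proof.
have [n] := ubnP #|S|; elim: n S K L => // n IHn S K L Sn admS.
have IH (K' L' : {set C}) (A : {set T}) : A \proper S -> admissible K' L' A ->
    #|A| <= gr_bound #|K'| #|L'|.
  by move=> /proper_card AS; apply: IHn; apply: leq_trans AS _.
case: (leqP #|S| 1) => [S1|S1]; first exact: leq_trans S1 (gr_bound_gt0 _ _).
have [f [p [q gp]]] := gallai_partition_exists (leqnn _) S1.
have [fS ff [u [v [uS vS uv]]] fc] := gp.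
have [_ cS _ _] := admS.
case: (classic (exists i, splits i S)) => [[i si]|ns].
  have [A [B [AB /set0Pn[a aA] /set0Pn[b bB] cAB]]] := si.
  have : i \in K :|: L.
    rewrite -(cedge_eq (cAB a b aA bB)) cS ?(cedge_neq (cAB a b aA bB)) //.
      by rewrite -AB inE aA.
    by rewrite -AB inE bB orbT.
  by case/setUP => iKL; [apply: (splits_K admS IH iKL)|apply: (splits_L admS IH iKL)].
have red : reduced S f p q by split=> // i si; apply: ns; exists i.
have red' := reducedC red.
(* Both [p] and [q] occur between parts, so they belong to [K] or [L]. *)
have inKL i j x : reduced S f i j -> x \in S -> i \in K :|: L.
  move=> rd xS; have [y yN] := outer_neq0 rd xS.
  have xy := part_outer rd xS (part_id _ xS) yN.
  by rewrite -(cedge_eq xy) cS ?(cedge_neq xy) // (outer_sub yN).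
have := inKL p q u red uS; have := inKL q p u red' uS.
case/setUP => qKL /setUP[] pKL.
- exact: (bound_KK_case admS IH red pKL qKL).
- exact: (bound_KL_case admS IH red' qKL pKL).
- exact: (bound_KL_case admS IH red pKL qKL).
- exact: (bound_LL_case admS IH red pKL qKL).
Qed.
End GallaiColoring.

(** * Lower bound *)

Definition H1_free (T C : finType) (c : T -> T -> C) i := forall x y z w v,
  [/\ cedge c i x y, cedge c i x z & cedge c i x w] ->
  [/\ cedge c i y z, cedge c i y w & cedge c i z w] ->
  [/\ v != y, v != z & v != w] -> ~ cedge c i v x.

(** Avoiding H_1 also avoids H_2, which contains it. Any finite type may be the vertex set, so that
    products can be used. *)
Definition avoidable (C : finType) (K L : {set C}) n :=
  exists (T : finType) (c : T -> T -> C), [/\ #|T| = n, forall x y, c x y = c y x,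
    forall x y z, x != y -> y != z -> x != z ->
      [|| c x y == c y z, c y z == c x z | c x y == c x z],
    forall x y, x != y -> c x y \in K :|: L &
    (forall i, i \in K -> ~ has_triangle c i setT) /\
    (forall i, i \in L -> H1_free c i)].

(** * Blow-ups of two-colored graphs *)

Section Substitution.
Variables (T0 C : finType) (e : rel T0) (i j : C).

(** [i = j] is allowed, so that K_2 in one color is covered. *)
Definition bicoloring a b := if e a b then i else j.

Lemma no_mono_triangle m : i != j ->
  (forall a b d, a != b -> a != d -> b != d ->
     ~~ ((e a b == e a d) && (e a b == e b d))) ->
  ~ has_triangle bicoloring m setT.
Proof.
move=> ij he [a [b [d [_ [/andP[ab +] /andP[ad +] /andP[bd +]]]]]].
have nji : (j == i) = false by rewrite eq_sym (negbTE ij).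
move: (he a b d ab ad bd); rewrite /bicoloring => h /eqP<-; move: h.
by do 3!case: (e _ _); rewrite ?(negbTE ij) ?nji.
Qed.

Lemma no_mono_K4 m : i != j ->
  (forall a b d g, [/\ a != b, a != d & a != g] -> [/\ b != d, b != g & d != g] ->
     ~~ [&& e a b == e a d, e a b == e a g, e a b == e b d, e a b == e b g &
         e a b == e d g]) ->
  ~ has_K4 bicoloring m setT.
Proof.
move=> ij he [a [b [d [g [_]]]]].
case=> /andP[ab +] /andP[ad +] /andP[ag +] /andP[bd +] [/andP[bg +] /andP[dg +]].
have nji : (j == i) = false by rewrite eq_sym (negbTE ij).
have := he a b d g (And3 ab ad ag) (And3 bd bg dg).
rewrite /bicoloring => h /eqP<-; move: h.
by do 6!case: (e _ _); rewrite ?(negbTE ij) ?nji.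
Qed.

Hypothesis esym : symmetric e.

(** Every vertex of [T0] is replaced by a copy of the smaller coloring. Old colors stay inside
    copies, which confines a connected target to one copy; [i] and [j] occur only between copies, so
    their cliques project injectively to [T0]. *)
Lemma avoidable_substitution (K K' L L' : {set C}) n : [disjoint K & L] ->
  K' \subset K -> L' \subset L -> i \in (K :|: L) :\: (K' :|: L') ->
  j \in (K :|: L) :\: (K' :|: L') ->
  (forall m, m \in K -> m \notin K' -> ~ has_triangle bicoloring m setT) ->
  (forall m, m \in L -> m \notin L' -> ~ has_K4 bicoloring m setT) ->
  avoidable K' L' n -> avoidable K L (#|T0| * n).
Proof.
move=> dKL KK LL /setDP[iKL iN] /setDP[jKL jN] hK hL.
case=> T [c' [cT csym' cgal' cin' [tri' free']]].
pose c (u v : T0 * T) := if u.1 == v.1 then c' u.2 v.2 else bicoloring u.1 v.1.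
have bic a b : bicoloring a b = i \/ bicoloring a b = j.
  by rewrite /bicoloring; case: ifP; [left|right].
have bsym a b : bicoloring a b = bicoloring b a by rewrite /bicoloring esym.
have neq2 u v : u != v -> u.1 == v.1 -> u.2 != v.2.
  by case: u v => [a x] [b y] /= + /eqP ab; rewrite ab xpair_eqE eqxx.
have inn m u v : m \in K' :|: L' -> cedge c m u v ->
    u.1 = v.1 /\ cedge c' m u.2 v.2.
  move=> mN /andP[uv]; rewrite /c; case: ifP => [e1|_] /eqP cm.
    by split; [apply/eqP|rewrite /cedge cm eqxx neq2].
  by case: (bic u.1 v.1) => em; rewrite -cm em ?(negbTE iN) ?(negbTE jN) in mN.
have out m u v : m \notin K' :|: L' -> cedge c m u v -> cedge bicoloring m u.1 v.1.
  move=> mN /andP[uv]; rewrite /c; case: ifP => [e1|e1] /eqP cm.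
    by move: mN; rewrite -cm cin' // neq2.
  by rewrite /cedge e1 cm eqxx.
exists (T0 * T)%type, c; split.
- by rewrite card_prod cT.
- by move=> u v; rewrite /c eq_sym csym' bsym.
- move=> u v w uv vw uw; rewrite /c.
  case: (eqVneq u.1 v.1) => [e1|n1]; case: (eqVneq v.1 w.1) => [e2|n2].
  + rewrite e1 e2 eqxx; apply: cgal'; apply: neq2 => //; by rewrite ?e1 ?e2.
  + by rewrite e1 (negbTE n2) eqxx orbT.
  + by rewrite -e2 (negbTE n1) eqxx !orbT.
  + case: (eqVneq u.1 w.1) => [e3|n3]; first by rewrite e3 bsym eqxx.
    by rewrite /bicoloring; do 3!case: (e _ _); rewrite ?eqxx ?orbT.
- move=> u v uv; rewrite /c; case: ifP => e1.
    by apply: (subsetP (setUSS KK LL)); apply: cin'; exact: neq2.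
  by case: (bic u.1 v.1) => ->.
- split=> m mKL.
    case: (boolP (m \in K')) => mK'.
      have mN : m \in K' :|: L' by rewrite inE mK'.
      case=> u [v [w [_ [/(inn _ _ _ mN)[_ uv] /(inn _ _ _ mN)[_ uw] /(inn _ _ _ mN)[_ vw]]]]].
      by apply: (tri' m mK'); exists u.2, v.2, w.2.
    have mN : m \notin K' :|: L'.
      rewrite inE negb_or mK' /=; apply: contraFN (disjointFr dKL mKL).
      exact: subsetP.
    case=> u [v [w [_ [/(out _ _ _ mN) uv /(out _ _ _ mN) uw /(out _ _ _ mN) vw]]]].
    by apply: (hK m mKL mK'); exists u.1, v.1, w.1.
  move=> x y z w v [xy xz xw] [yz yw zw] [vy vz vw] vx.
  case: (boolP (m \in L')) => mL'.
    have mN : m \in K' :|: L' by rewrite inE mL' orbT.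
    have E a b := @inn m a b mN.
    have [xy1 xy2] := E _ _ xy; have [xz1 xz2] := E _ _ xz.
    have [xw1 xw2] := E _ _ xw; have [vx1 vx2] := E _ _ vx.
    have [_ yz2] := E _ _ yz; have [_ yw2] := E _ _ yw; have [_ zw2] := E _ _ zw.
    apply: (free' m mL' x.2 y.2 z.2 w.2 v.2) => //.
    by split; apply: neq2; rewrite // vx1; apply/eqP.
  have mN : m \notin K' :|: L'.
    rewrite inE negb_or mL' andbT; apply: contraFN (disjointFl dKL mKL).
    exact: subsetP.
  have E a b := @out m a b mN.
  apply: (hL m mKL mL'); exists x.1, y.1, z.1, w.1; split=> //.
  by split; [| | | |split]; apply: E.
Qed.

Lemma avoidable_substitution_K (K L : {set C}) n : [disjoint K & L] ->
  i \in K -> j \in K -> (forall m, ~ has_triangle bicoloring m setT) ->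
  avoidable (K :\ i :\ j) L n -> avoidable K L (#|T0| * n).
Proof.
move=> dKL iK jK nt; apply: avoidable_substitution => //.
- by apply: subset_trans (subD1set _ _) (subD1set _ _).
- by rewrite !inE iK (disjointFr dKL iK) eqxx andbF.
- by rewrite !inE jK (disjointFr dKL jK) eqxx.
- by move=> m ->.
Qed.

Lemma avoidable_substitution_L (K L : {set C}) n : [disjoint K & L] ->
  i \in L -> j \in L -> (forall m, ~ has_K4 bicoloring m setT) ->
  avoidable K (L :\ i :\ j) n -> avoidable K L (#|T0| * n).
Proof.
move=> dKL iL jL nt; apply: avoidable_substitution => //.
- by apply: subset_trans (subD1set _ _) (subD1set _ _).
- by rewrite !inE iL (disjointFl dKL iL) eqxx andbF orbT.
- by rewrite !inE jL (disjointFl dKL jL) eqxx orbT.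
- by move=> m ->.
Qed.
End Substitution.

(** * Explicit colorings and the extremal construction *)

Definition pentagon a b := (a + 5 - b) %% 5 \in [:: 1; 4].

(** The list consists of the nonzero squares modulo 17; adding 17 avoids truncated subtraction. *)
Definition paley17 a b := (a + 17 - b) %% 17 \in [:: 1; 2; 4; 8; 9; 13; 15; 16].


(** Turns a statement about all of ['I_n] into a boolean check that [vm_compute] can evaluate. *)
Lemma ordP n (P : pred nat) : all P (iota 0 n) -> forall a : 'I_n, P a.
Proof. by move=> /allP h a; apply: h; rewrite mem_iota ltn_ord. Qed.

Lemma pentagon_sym : symmetric (fun a b : 'I_5 => pentagon a b).
Proof.
have: all (fun a => all (fun b => pentagon a b == pentagon b a) (iota 0 5)) (iota 0 5).
  by vm_compute.
by move=> /ordP h a b; apply/eqP; apply: (ordP (h a)).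
Qed.

Lemma pentagon_no_triangle (a b d : 'I_5) : a != b -> a != d -> b != d ->
  ~~ ((pentagon a b == pentagon a d) && (pentagon a b == pentagon b d)).
Proof.
have: all (fun a => all (fun b => all (fun d =>
    [|| a == b, a == d, b == d |
      ~~ ((pentagon a b == pentagon a d) && (pentagon a b == pentagon b d))])
    (iota 0 5)) (iota 0 5)) (iota 0 5) by vm_compute.
move=> /ordP h; have := ordP (ordP (h a) b) d.
by rewrite -!val_eqE; do 3!case: (_ == _ :> nat).
Qed.

Lemma paley17_sym : symmetric (fun a b : 'I_17 => paley17 a b).
Proof.
have: all (fun a => all (fun b => paley17 a b == paley17 b a) (iota 0 17)) (iota 0 17).
  by vm_compute.
by move=> /ordP h a b; apply/eqP; apply: (ordP (h a)).
Qed.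

Lemma paley17_no_K4 (a b d g : 'I_17) : [/\ a != b, a != d & a != g] ->
  [/\ b != d, b != g & d != g] ->
  ~~ [&& paley17 a b == paley17 a d, paley17 a b == paley17 a g,
         paley17 a b == paley17 b d, paley17 a b == paley17 b g &
         paley17 a b == paley17 d g].
Proof.
have: all (fun a => all (fun b => all (fun d => all (fun g =>
    [|| a == b, a == d, a == g, b == d, b == g, d == g |
      ~~ [&& paley17 a b == paley17 a d, paley17 a b == paley17 a g,
         paley17 a b == paley17 b d, paley17 a b == paley17 b g &
         paley17 a b == paley17 d g]])
    (iota 0 17)) (iota 0 17)) (iota 0 17)) (iota 0 17) by vm_compute.
move=> /ordP h; have := ordP (ordP (ordP (h a) b) d) g.
have neq (u v : 'I_17) : u != v -> (u == v :> nat) = false by move/negbTE.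
by move=> + [ab ad ag] [bd bg dg]; rewrite !neq.
Qed.

Lemma avoidable_point (C : finType) (c0 : C) : avoidable (@set0 C) set0 1.
Proof.
exists unit, (fun _ _ => c0); split.
- by rewrite card_unit.
- by [].
- by case; case.
- by case; case.
- by split=> m; rewrite inE.
Qed.

Lemma avoidable_K4 (C : finType) (i : C) : avoidable set0 [set i] 4.
Proof.
exists 'I_4, (fun _ _ => i); split.
- by rewrite card_ord.
- by [].
- by move=> x y z; rewrite eqxx.
- by move=> x y _; rewrite !inE eqxx.
split=> m; first by rewrite inE.
move=> _ x y z w v [/cedge_neq xy /cedge_neq xz /cedge_neq xw].
move=> [/cedge_neq yz /cedge_neq yw /cedge_neq zw] [vy vz vw] /cedge_neq vx.
have /card_uniqP : uniq [:: v; x; y; z; w].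
  by rewrite /= !inE !negb_or vx vy vz vw xy xz xw yz yw zw.
by move=> /= e; have := max_card (mem [:: v; x; y; z; w]); rewrite e card_ord.
Qed.

(** Pairs of [K] are removed first, then a single color of [K], then pairs of [L]. A last color of
    [L] is the innermost K_4, since a blow-up of it would contain H_1. *)
Theorem avoidable_gr_bound (C : finType) (c0 : C) n (K L : {set C}) :
  #|K| + #|L| <= n -> [disjoint K & L] -> avoidable K L (gr_bound #|K| #|L|).
Proof.
elim: n K L => [|n IH] K L nKL dKL.
  have [K0 L0] : #|K| = 0 /\ #|L| = 0 by lia.
  rewrite K0 L0 (cards0_eq K0) (cards0_eq L0); exact: avoidable_point.
have dK (A B : {set C}) : A \subset K -> B \subset L -> [disjoint A & B].
  by move=> AK BL; apply: disjointWl AK (disjointWr BL dKL).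
have D2 (A : {set C}) i j : A :\ i :\ j \subset A.
  exact: subset_trans (subD1set _ _) (subD1set _ _).
case: (ltnP 1 #|K|) => [/card_gt1P[i [j [iK jK ij]]]|K1].
  have eK : #|K| = #|K :\ i :\ j|.+2.
    by rewrite (cardsD1 i) iK (cardsD1 j) !inE jK eq_sym ij.
  rewrite eK gr_bound_SS -[5]card_ord.
  apply: (avoidable_substitution_K (e := fun a b : 'I_5 => pentagon a b) pentagon_sym dKL iK jK).
    by move=> m; apply: no_mono_triangle ij pentagon_no_triangle.
  by apply: IH (dK _ _ (D2 _ _ _) (subxx _)); move: nKL; rewrite eK; clear; lia.
case: (set_0Vmem K) => [K0|[i iK]]; last first.
  (* The substitution lemma is used with both colors equal to [i], on K_2. *)
  have eK : #|K| = #|K :\ i :\ i|.+1.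
    by rewrite [K :\ i :\ i]setDDl setUid (cardsD1 i) iK.
  have eD : #|K :\ i :\ i| = 0 by move: K1; rewrite eK; clear; lia.
  have -> : gr_bound #|K| #|L| = #|{: bool}| * gr_bound #|K :\ i :\ i| #|L|.
    by rewrite card_bool eK eD /gr_bound /triangle_factor /= !muln1 mul1n.
  apply: (avoidable_substitution_K (e := fun _ _ : bool => true) _ dKL iK iK) => //.
    by move=> m [[] [[] [[] [_ []]]]]; rewrite /cedge.
  by apply: IH (dK _ _ (D2 _ _ _) (subxx _)); move: nKL; rewrite eK; clear; lia.
case: (ltnP 1 #|L|) => [/card_gt1P[i [j [iL jL ij]]]|L1].
  have eL : #|L| = #|L :\ i :\ j|.+2.
    by rewrite (cardsD1 i) iL (cardsD1 j) !inE jL eq_sym ij.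
  rewrite eL gr_bound_rSS -[17]card_ord.
  apply: (avoidable_substitution_L (e := fun a b : 'I_17 => paley17 a b) paley17_sym dKL iL jL).
    by move=> m; apply: no_mono_K4 ij paley17_no_K4.
  by apply: IH (dK _ _ (subxx _) (D2 _ _ _)); move: nKL; rewrite eL; clear; lia.
rewrite K0 cards0; case: (set_0Vmem L) => [->|[i iL]].
  by rewrite cards0; exact: avoidable_point.
have L1' : #|L| = 1 by apply/eqP; rewrite eqn_leq L1 (cardD1 i) iL.
have -> : L = [set i].
  by apply/eqP; rewrite eq_sym eqEcard sub1set iL cards1 L1'.
by rewrite cards1; exact: avoidable_K4.
Qed.

(** * Copies of graphs in terms of color classes *)

Lemma mono_triangle n k (c : 'I_n -> 'I_n -> 'I_k) i :
  (forall x y, c x y = c y x) ->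
  mono_copy c (complete_graph 3) i <-> has_triangle c i setT.
Proof.
move=> csym; split=> [[f [finj fc]]|[x [y [z [_ [xy xz yz]]]]]].
  have e (u v : 'I_3) : u != v -> cedge c i (f u) (f v).
    by move=> uv; rewrite /cedge (inj_eq finj) uv (fc u v uv) eqxx.
  exists (f ord0), (f (inord 1)), (f (inord 2)); split; first by [].
  by split; apply: e; rewrite -val_eqE /= ?inordK.
exists (fun u : 'I_3 => nth x [:: x; y; z] u); split.
  move=> u v /eqP; rewrite nth_uniq ?ltn_ord //; first by move/eqP/ord_inj.
  by rewrite /= !inE !negb_or (cedge_neq xy) (cedge_neq xz) (cedge_neq yz).
case=> [[|[|[|u]]] hu] // [[|[|[|v]]] hv] // _ /=; apply: cedge_eq => //;
  by rewrite cedgeC.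
Qed.

(** For [0 < d], [K4_plus d] contains H_1. *)
Lemma K4_plus_copy_H1_free n k (c : 'I_n -> 'I_n -> 'I_k) i d : 0 < d ->
  mono_copy c (K4_plus d) i -> ~ H1_free c i.
Proof.
move=> d0 [f [finj fc]] hf.
have e (u v : K4_plus d) : adj u v -> cedge c i (f u) (f v).
  move=> uv; rewrite /cedge (fc u v uv) eqxx andbT (inj_eq finj).
  by apply: contraTneq uv => ->; rewrite adj_irr.
pose g m : K4_plus d := Some (inord m : 'I_4).
have eg a b : a < 4 -> b < 4 -> a != b -> cedge c i (f (g a)) (f (g b)).
  by move=> a4 b4 ab; apply: e; rewrite /= -val_eqE /= !inordK.
apply: (hf (f (g 0)) (f (g 1)) (f (g 2)) (f (g 3)) (f None)).
- by split; apply: eg.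
- by split; apply: eg.
- by split; rewrite (inj_eq finj).
- by apply: e; rewrite /= inordK.
Qed.

(** For [d <= 2], [K4_plus d] is a subgraph of H_2. *)
Lemma H2_free_copy n k (c : 'I_n -> 'I_n -> 'I_k) i d :
  (forall x y, c x y = c y x) -> d <= 2 ->
  ~ mono_copy c (K4_plus d) i -> H2_free c i setT.
Proof.
move=> csym d2 nm x y z w v _ _ [xy xz xw] [yz yw zw] vz vw vx vy; apply: nm.
pose s := [:: x; y; z; w].
have us : uniq s.
  by rewrite /= !inE !negb_or !(cedge_neq xy, cedge_neq xz, cedge_neq xw,
     cedge_neq yz, cedge_neq yw, cedge_neq zw).
have vs : v \notin s.
  by rewrite !inE !negb_or (cedge_neq vx) (cedge_neq vy) vz vw.
exists (fun o : K4_plus d => if o is Some u then nth x s (u : 'I_4) else v); split.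
  case=> [a|] [b|] //.
  - by move/eqP; rewrite nth_uniq ?ltn_ord // => /eqP/ord_inj->.
  - by move=> e; rewrite -e mem_nth ?ltn_ord // in vs.
  - by move=> e; rewrite e mem_nth ?ltn_ord // in vs.
have es (a b : 'I_4) : a != b -> c (nth x s a) (nth x s b) = i.
  by move: a b => [[|[|[|[|a]]]] ha] // [[|[|[|[|b]]]] hb] // _;
    apply: cedge_eq => //=; rewrite cedgeC.
have ev (a : 'I_4) : a < d -> c v (nth x s a) = i.
  by move=> /leq_trans/(_ d2); move: a => [[|[|a]] ha] // _; apply: cedge_eq.
case=> [a|] [b|] //; first exact: es.
- by move=> ad; rewrite csym ev.
- exact: ev.
Qed.

Lemma uniq3_rainbow n k (c : 'I_n -> 'I_n -> 'I_k) x y z :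
  x != y -> y != z -> x != z -> ~~ rainbow_triangle c x y z =
  [|| c x y == c y z, c y z == c x z | c x y == c x z].
Proof.
move=> xy yz xz; rewrite /rainbow_triangle /= !inE negb_or xy xz yz /=.
by do 3!case: (_ == _).
Qed.

Lemma widen_ord_inj n m (nm : n <= m) : injective (widen_ord nm).
Proof. by move=> x y /(congr1 val) /= /val_inj. Qed.

Lemma targets_card k r : r <= k ->
  #|[set i : 'I_k | i < r]| = r /\ #|~: [set i : 'I_k | i < r]| = k - r.
Proof.
move=> hr; have e : #|[set i : 'I_k | i < r]| = r.
  rewrite -[RHS]card_ord -(card_imset _ (widen_ord_inj (nm := hr))).
  apply: eq_card => i; rewrite inE; apply/idP/imsetP => [ir|[j _ ->]]; last exact: (ltn_ord j).
  by exists (Ordinal ir) => //; apply: val_inj.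
by split=> //; have := cardsC [set i : 'I_k | i < r]; rewrite e card_ord; lia.
Qed.

Lemma gr_bound_cases a b :
  match odd a, odd b with
  | false, false => 5 ^ a./2 * 17 ^ b./2 + 1
  | true, false => 2 * 5 ^ (a - 1)./2 * 17 ^ b./2 + 1
  | true, true => 8 * 5 ^ (a - 1)./2 * 17 ^ (b - 1)./2 + 1
  | false, true => 4 * 5 ^ a./2 * 17 ^ (b - 1)./2 + 1
  end = (gr_bound a b).+1.
Proof.
have h m : odd m -> (m - 1)./2 = m./2.
  by case: m => //= m; rewrite subn1 /= uphalf_half => /negbTE->.
rewrite /gr_bound /triangle_factor /H_factor addn1.
case: (boolP (odd a)) => [/h->|_]; case: (boolP (odd b)) => [/h->|_]; lia.
Qed.

Theorem theorem1p4 (H : sgraph) (hH : H = H1 \/ H = H2)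
    (k r : nat) (hk : 1 <= k) (hr : r <= k) :
  is_GR (@targets k r H)
    (match odd (k - r), odd r with
     | false, false => 5 ^ (k - r)./2 * 17 ^ r./2 + 1
     | true, false => 2 * 5 ^ (k - r - 1)./2 * 17 ^ r./2 + 1
     | true, true => 8 * 5 ^ (k - r - 1)./2 * 17 ^ (r - 1)./2 + 1
     | false, true => 4 * 5 ^ (k - r)./2 * 17 ^ (r - 1)./2 + 1
     end).
Proof.
rewrite gr_bound_cases.
pose L := [set i : 'I_k | i < r]; pose K := ~: L.
have [cL cK] := targets_card hr.
have [d [-> d0 d2]] : exists d, [/\ H = K4_plus d, 0 < d & d <= 2].
  by case: hH => ->; [exists 1|exists 2].
have dKL : [disjoint K & L] by rewrite disjoints_subset subxx.
have tK i : i \in K -> targets r (K4_plus d) i = complete_graph 3.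
  by rewrite !inE /targets => /negbTE->.
have tL i : i \in L -> targets r (K4_plus d) i = K4_plus d.
  by rewrite inE /targets => ->.
split=> [c [csym cgal]|n arrows].
  apply: NNPP => nm.
  have nmi i : ~ mono_copy c (targets r (K4_plus d) i) i.
    by move=> h; apply: nm; exists i.
  have cgal' x y z : x != y -> y != z -> x != z ->
      [|| c x y == c y z, c y z == c x z | c x y == c x z].
    by move=> xy yz xz; rewrite -uniq3_rainbow.
  have adm : admissible c K L setT.
    split=> // [x y _ _ _|i iK /(mono_triangle _ csym) m|i iL].
    - by rewrite setUC setUCr inE.
    - by apply: (nmi i); rewrite tK.
    - by apply: (H2_free_copy csym d2); rewrite -(tL i iL).
  have := admissible_bound csym cgal' adm.
  by rewrite cardsT card_ord cL cK ltnn.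
rewrite leqNgt ltnS; apply/negP => nf.
(* Since [1 <= k], there is a color to define the coloring of a single point. *)
have [c0] : exists c0 : 'I_k, true by exists (Ordinal hk).
move=> _; have := avoidable_gr_bound c0 (leqnn _) dKL; rewrite cL cK.
case=> T [c [cT csym cgal cin [nt nH]]].
have nT : n <= #|T| by rewrite cT.
(* The extremal coloring is restricted to [n] of its vertices. *)
pose g (x : 'I_n) : T := enum_val (widen_ord nT x).
have ginj : injective g by move=> x y /enum_val_inj/widen_ord_inj.
pose c' x y := c (g x) (g y).
have cs' x y : c' x y = c' y x by exact: csym.
have [|i] := arrows c'.
  split=> // x y z; apply/negP => rb; have := rb => /andP[+ _].
  rewrite /= !inE negb_or andbT => /andP[/andP[xy xz] yz].
  by move: rb; apply/negP; rewrite uniq3_rainbow // cgal ?(inj_eq ginj).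
have eg j x y : cedge c' j x y = cedge c j (g x) (g y).
  by rewrite /cedge (inj_eq ginj).
case: (boolP (i \in L)) => iL.
  rewrite tL // => /(K4_plus_copy_H1_free d0); apply.
  move=> x y z w v; rewrite !eg => e1 e2 [vy vz vw].
  by apply: (nH i iL) e1 e2 _; rewrite !(inj_eq ginj).
have iK : i \in K by rewrite inE.
rewrite tK // mono_triangle // => -[x [y [z [_]]]]; rewrite !eg => e.
by apply: (nt i iK); exists (g x), (g y), (g z).
Qed.
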